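(* Let $(\theta_n)_{n\in\mathbb{N}}$ be a sequence of pairwise distinct real numbers in $[0,1)$ and let $(m_s)_{s\in\mathbb{N}}$ be an unbounded sequence of complex numbers. Let $SA$ be the set of all entire functions $f\in\mathcal{H}(\mathbb{C})$ with the following property: for every $g\in\mathcal{H}(\mathbb{C})$ there is a sequence $(\lambda_n)_{n\in\mathbb{N}}$ with $\lambda_n\in\{m_s : s\in\mathbb{N}\}$ for every $n\in\mathbb{N}$, such that for every $a\in\{\theta_j : j\in\mathbb{N}\}$ and every compact set $K\subseteq\mathbb{C}$, $$\sup_{z\in K}\big|f(z+\lambda_n e^{2\pi i a})-g(z)\big|\to 0\quad\text{as } n\to+\infty.$$ Then $SA$ is a dense $G_\delta$ subset of $\mathcal{H}(\mathbb{C})$. In particular, $SA$ is non-empty.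
   Context: $\mathbb{N}=\{1,2,3,\dots\}$. $\mathcal{H}(\mathbb{C})$ is the space of entire functions $\mathbb{C}\to\mathbb{C}$, endowed with the topology of uniform convergence on compact subsets of $\mathbb{C}$. In the definition of $SA$ the sequence $(\lambda_n)$ may depend on $f$ and $g$ but not on $a$ or $K$; its terms need not be distinct. *)

(* Defs.v *)
From mathcomp Require Import all_boot all_order all_algebra.
From mathcomp Require Import complex.
From mathcomp Require Import all_classical all_reals all_analysis.
Set Implicit Arguments.
Unset Strict Implicit.
Unset Printing Implicit Defensive.
Import Order.TTheory GRing.Theory Num.Theory.
Import numFieldNormedType.Exports.
Local Open Scope classical_set_scope.
Local Open Scope ring_scope.

(* The complex plane over R. The regular module [R[i]^o] is what carries the
   topology and the normed space structure over the field [R[i]] itself. *)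
Notation Cplane R := (R[i]^o).

(* [derivable f z 1] takes the limit of difference quotients along increments
   in [R[i]], so this is complex differentiability at every point. *)
Definition entire (R : realType) (f : Cplane R -> Cplane R) : Prop :=
  forall z : Cplane R, derivable f z 1.

(* As a [set_type], this carries the topology induced by that of uniform
   convergence on compact sets. *)
Definition entire_space (R : realType) :=
  set_type [set f : {family compact, Cplane R -> Cplane R} | entire f].

Definition entire_fun (R : realType) (f : entire_space R) :
  Cplane R -> Cplane R := set_val f.
Coercion entire_fun : entire_space >-> Funclass.

(* exp (2 pi i a) *)
Definition cexp2pi (R : realType) (a : R) : Cplane R :=
  (cos (2 * pi * a) +i* sin (2 * pi * a))%C.

(* The least upper bound of |h| on K, as a real number. The conventions of
   [sup] give 0 when K is empty (or when h is unbounded on K, which does not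
   happen for K compact and h continuous). *)
Definition sup_norm_on (R : realType) (K : set (Cplane R))
    (h : Cplane R -> Cplane R) : R :=
  sup [set ComplexField.Normc.normc (h z) | z in K].

Definition SA (R : realType) (theta : nat -> R) (m : nat -> Cplane R) :
    set (entire_space R) :=
  [set f | forall g : entire_space R, exists lambda : nat -> Cplane R,
    (forall n, range m (lambda n)) /\
    forall a : R, range theta a ->
    forall K : set (Cplane R), compact K ->
      sup_norm_on K (fun z => f (z + lambda n * cexp2pi a) - g z)
        @[n --> \oo] --> (0 : R)].

(* Main.v *)
Require Import Defs.
From mathcomp Require Import all_boot all_order all_algebra.
From mathcomp Require Import complex.
From mathcomp Require Import all_classical all_reals all_analysis.
From mathcomp Require Import borel_hierarchy.
From mathcomp Require Import ring lra.
Set Implicit Arguments.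
Unset Strict Implicit.
Unset Printing Implicit Defensive.
Import Order.TTheory GRing.Theory Num.Theory.
Import numFieldNormedType.Exports.
Local Open Scope classical_set_scope.
Local Open Scope ring_scope.

Local Notation nm := ComplexField.Normc.normc.

(** [SA] is a countable intersection of open sets. Fix a countable dense family
    of entire functions [p i], listed so that each entire function has
    approximants of arbitrarily large index ([entire_countable_dense]). Then
    [f] is in [SA] iff for every [i] some [m s] brings [f] within [1 / (i + 1)]
    of [p i] on the disc of radius [i], simultaneously in the first [i]
    directions [theta l] ([SA_bigcap]), and each of these conditions is open
    ([open_approximates]).

    To see that one such condition is dense, let [u] and [p] be entire. The
    points [0] and [e(theta l) = exp (2 pi i theta l)] are pairwise distinct, so
    when [|m s|] is large the discs of a given radius around [0] and around
    [c l = m s * e(theta l)] are small compared with their mutual distances. If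
    [phi l] is entire, close to [1] on the disc around [c l] and close to [0] on
    the other ones, then [u + \sum_l phi l * (p (. - c l) - u)] is close to [u]
    around [0] and to [p (. - c l)] around each [c l] ([universal_step]). Such
    [phi l] are explicit polynomials ([exists_bump]): the Lagrange polynomial at
    the nodes [0] and [e(theta l)], in the variable [z / m s], is within [1/16]
    of the wanted values on all the discs, and iterating [3 w^2 - 2 w^3], which
    has [0] and [1] as superattracting fixed points, improves this at will.

    Density of the intersection is a Baire argument ([tame_baire]). Successive
    corrections are made small together with their Lipschitz constants on
    larger and larger discs; difference quotients then converge uniformly, so
    that differentiability passes to the limit ([tame_limit]) without any
    recourse to the theorem of Weierstrass. The construction has to start from
    locally Lipschitz entire functions, and their density among all the entire
    functions is where complex analysis is used ([tame_approx]): by Goursat's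
    theorem ([triangle_eq0]) an entire [f] has a primitive, so the averages of
    [f] over the segments from [z] to [z + h] form an entire, locally Lipschitz
    function of [z], which tends to [f] locally uniformly as [h] tends to [0]. *)

(** * The complex plane with real-valued modulus *)
Section Plane.
Variable R : realType.
Local Notation C := (Cplane R).
Implicit Types (z w : C) (r e : R).

Lemma norm_nm z : `|z| = ((nm z)%:C)%C :> R[i]. Proof. by []. Qed.

Lemma nmD z w : nm (z + w) <= nm z + nm w.
Proof. exact: le_normcD. Qed.

Lemma nmN z : nm (- z) = nm z. Proof. exact: normcN. Qed.

Lemma nmM z w : nm (z * w) = nm z * nm w.
Proof. exact: ComplexField.Normc.normcM. Qed.

Lemma nmV z : nm z^-1 = (nm z)^-1.
Proof. exact: ComplexField.Normc.normcV. Qed.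

Lemma nm0 : nm (0 : C) = 0. Proof. exact: ComplexField.Normc.normc0. Qed.

Lemma nm_ge0 z : 0 <= nm z. Proof. by case: z => x y; exact: sqrtr_ge0. Qed.

Lemma nm_gt0 z : (0 < nm z) = (z != 0).
Proof. by rewrite -ltcR -norm_nm normr_gt0. Qed.

Lemma nmB z w : nm (z - w) = nm (w - z).
Proof. by rewrite -nmN opprB. Qed.

Lemma nmBD u z w : nm (z - w) <= nm (z - u) + nm (u - w).
Proof. by rewrite -[leLHS]/(nm (z - w)) -(subrKA u z (- w)) nmD. Qed.

Lemma nm_real r : nm (r%:C)%C = `|r|.
Proof. by rewrite /= expr0n addr0 sqrtr_sqr. Qed.

Lemma nm_nat n : nm (n%:R : C) = n%:R.
Proof.
rewrite (_ : n%:R = ((n%:R : R)%:C)%C); last by rewrite rmorph_nat.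
by rewrite nm_real normr_nat.
Qed.

Lemma nm_ReIm (x y : R) : nm (x +i* y)%C <= `|x| + `|y|.
Proof.
rewrite -(@ler_pXn2r _ 2) ?nnegrE ?addr_ge0// ?nm_ge0//.
rewrite /= sqr_sqrtr ?addr_ge0 ?sqr_ge0// -(real_normK (num_real x)).
rewrite -(real_normK (num_real y)).
have := normr_ge0 x; have := normr_ge0 y; nra.
Qed.

Lemma nm_Re z : `|complex.Re z| <= nm z.
Proof. by rewrite -lecR; apply: normc_ge_Re. Qed.

Lemma nm_Im z : `|complex.Im z| <= nm z.
Proof.
case: z => x y /=; rewrite -sqrtr_sqr ler_wsqrtr// lerDr sqr_ge0//.
Qed.

(** Neighbourhoods in the plane are defined with radii in [R[i]]; every
    estimate below uses real radii. *)
Lemma nbhs_normcP z (P : set C) :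
  nbhs z P <-> exists2 e, 0 < e & forall w, nm (w - z) < e -> P w.
Proof.
rewrite -nbhs_nbhs_norm; split.
  move=> [e /= e0 He].
  have [r er] : exists r, e = (r)%:C%C by apply/complex_realP/gtr0_real.
  subst e; exists r; first by rewrite -ltcR.
  by move=> w wz; apply: He; rewrite /= distrC norm_nm ltcR.
move=> [e e0 He]; exists (e%:C)%C; rewrite /= ?ltcR// => w /=.
by rewrite distrC norm_nm ltcR => /He.
Qed.

Definition disc r : set C := [set z | nm z <= r].

Lemma disc_le r1 r2 z : r1 <= r2 -> disc r1 z -> disc r2 z.
Proof. by move=> r12 /le_trans; apply. Qed.

Lemma open_ball_nm z e : open [set w : C | nm (w - z) < e].
Proof.
rewrite openE => w /= wz; apply/nbhs_normcP; exists (e - nm (w - z)).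
  by rewrite subr_gt0.
by move=> u uw /=; apply: le_lt_trans (nmBD w _ _) _; lra.
Qed.

(** A disc is a closed subset of the image of a square of [R * R]. *)
Lemma compact_disc r : compact (disc r).
Proof.
have cont : continuous (fun p : R * R => (p.1 +i* p.2)%C : C).
  move=> [x y] P /nbhs_normcP[e e0 He].
  have e20 : 0 < e / 2 by rewrite divr_gt0.
  apply: filterS (nbhsx_ballx (x, y) (e / 2) e20) => -[a b] [/= xa yb].
  apply: He => /=; apply: le_lt_trans (nm_ReIm _ _) _.
  rewrite (distrC a) (distrC b); rewrite /ball/= in xa yb; lra.
have cS := compact_setX (@segment_compact R (- r) r) (@segment_compact R (- r) r).
have cI := continuous_compact (continuous_subspaceT cont) cS.
apply: (subclosed_compact _ cI).
  rewrite -openC openE => z /= /negP; rewrite -ltNge => rz.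
  apply/nbhs_normcP; exists (nm z - r); first by rewrite subr_gt0.
  move=> w wz /=; apply/negP; rewrite -ltNge.
  have := nmD w (z - w); rewrite addrC subrK nmB; lra.
move=> z zr; exists (complex.Re z, complex.Im z); last by case: (z).
by split; rewrite /= in_itv /= -ler_norml;
  [apply: le_trans (nm_Re z) zr | apply: le_trans (nm_Im z) zr].
Qed.

(** Compactness in the form that is used for uniform continuity, boundedness
    and countable codings alike. *)
Lemma compact_gauge (K : set C) (d : C -> R) : compact K ->
  (forall z, K z -> 0 < d z) ->
  exists2 s : seq C, (forall x, x \in s -> K x) &
    forall z, K z -> exists2 x, x \in s & nm (z - x) < d x.
Proof.
rewrite compact_cover => cK dp.
have [|z Kz|s sK Ks] := cK C K (fun x => [set w : C | nm (w - x) < d x]).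
- by move=> z _; exact: open_ball_nm.
- by exists z => //=; rewrite subrr nm0 dp.
- exists (finmap.enum_fset s); first by move=> x xs; have := sK _ xs; rewrite inE.
  by move=> z /Ks[x /= xs zx]; exists x.
Qed.

Lemma compact_sub_disc (K : set C) : compact K ->
  exists n : nat, K `<=` disc n%:R.
Proof.
move=> cK; have [|s sK Ks] := compact_gauge (d := fun=> 1) cK; first by [].
have [r rs] : exists r, forall x, x \in s -> nm x <= r.
  elim: s {sK Ks} => [|x s [r IH]]; first by exists 0.
  exists (Num.max (nm x) r) => y; rewrite inE le_max => /orP[/eqP->|/IH ->].
    by rewrite lexx.
  by rewrite orbT.
exists (Num.trunc (1 + r)).+1 => z /Ks[x /rs xr zx] /=.
rewrite /disc/=; apply/ltW/(@le_lt_trans _ _ (1 + r)); last exact: truncnS_gt.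
by rewrite -(subrK x z); apply: le_trans (nmD _ _) _; rewrite lerD// ltW.
Qed.

(** Completeness: a Cauchy filter contains a bounded set, and discs are
    compact. *)
Lemma plane_cauchy_cvg (F : set_system C) {FF : ProperFilter F} :
  (forall e, 0 < e -> exists z, F [set w | nm (w - z) < e]) -> cvg F.
Proof.
move=> Fe.
have [z0 Fz0] := Fe 1 ltr01.
apply: (compact_cauchy_cvg (U := disc (nm z0 + 1))).
- move=> A; rewrite -entourage_ballE => -[e /= e0 eA].
  have [r er] : exists r, e = (r)%:C%C by apply/complex_realP/gtr0_real.
  subst e; have r0 : 0 < r by rewrite -ltcR.
  have r20 : 0 < r / 2 by rewrite divr_gt0.
  have [z Fz] := Fe _ r20.
  exists ([set w | nm (w - z) < r / 2], [set w | nm (w - z) < r / 2]) => //.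
  move=> [u v] [/= uz vz]; apply: eA => /=.
  rewrite -ball_normE /= norm_nm ltcR.
  by apply: le_lt_trans (nmBD z _ _) _; rewrite (nmB z); lra.
- apply: filterS Fz0 => w /= wz; rewrite /disc/=.
  by have := nmD (w - z0) z0; rewrite subrK; lra.
- exact: compact_disc.
Qed.

End Plane.

(** * Differentiability, uniform continuity and limits with real radii *)
Section Differentiation.
Variable R : realType.
Local Notation C := (Cplane R).
Implicit Types (z w : C) (r e : R) (f g : C -> C).

Definition cdiff f z d := forall e, 0 < e -> exists2 t, 0 < t &
  forall w, nm (w - z) < t -> nm (f w - f z - d * (w - z)) <= e * nm (w - z).

Lemma derivable_cdiff f z : derivable f z 1 <-> exists d : C, cdiff f z d.
Proof.
split.
  move=> /cvg_ex[d Hd]; exists d => e e0.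
  have /Hd : nbhs (d : C) [set w : C | nm (w - d) < e].
    by apply/nbhs_normcP; exists e.
  move=> /nbhs_normcP[t t0 Ht]; exists t => // w wz.
  have [->|wz0] := eqVneq w z; first by rewrite !subrr mulr0 subrr nm0 mulr0.
  have wz0' : w - z != 0 by rewrite subr_eq0.
  have := Ht (w - z); rewrite subr0 => /(_ wz wz0') /=.
  rewrite -[_ *: 1]/(_ * 1) mulr1 subrK -[_ *: _]/(_ * _) => lte.
  rewrite (_ : _ - _ = ((w - z)^-1 * (f w - f z) - d) * (w - z)); last by field.
  by rewrite nmM ler_wpM2r ?nm_ge0// ltW.
move=> [d Hd]; apply/cvg_ex; exists d => P /nbhs_normcP[e e0 He].
have e20 : 0 < e / 2 by rewrite divr_gt0.
have [t t0 Ht] := Hd _ e20.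
apply/nbhs_normcP; exists t => // h; rewrite subr0 => ht h0.
apply: He => /=; rewrite -[_ *: 1]/(_ * 1) mulr1 -[_ *: _]/(_ * _).
have := Ht (h + z); rewrite addrK => /(_ ht) lte.
have h0' : 0 < nm h by rewrite nm_gt0.
rewrite (_ : _ - d = (f (h + z) - f z - d * h) * h^-1); last by field.
rewrite nmM nmV; apply: (@le_lt_trans _ _ (e / 2)); last lra.
by rewrite ler_pdivrMr.
Qed.

Definition ccont f := forall z e, 0 < e ->
  exists2 t, 0 < t & forall w, nm (w - z) < t -> nm (f w - f z) < e.

Lemma cdiff_cont f z d e : cdiff f z d -> 0 < e ->
  exists2 t, 0 < t & forall w, nm (w - z) < t -> nm (f w - f z) < e.
Proof.
move=> /(_ 1 ltr01)[t t0 Ht] e0.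
have D0 : 0 < nm d + 1 by rewrite ltr_wpDl ?nm_ge0.
exists (Num.min t (e / (nm d + 1))); first by rewrite lt_min t0 divr_gt0.
move=> w; rewrite lt_min ltr_pdivlMr// => /andP[/Ht wt we].
rewrite -(subrK (d * (w - z)) (f w - f z)).
apply: le_lt_trans (nmD _ _) _; rewrite nmM; nra.
Qed.

Lemma entire_cont f : entire f -> ccont f.
Proof.
move=> ef z e e0; have [d fd] := (derivable_cdiff f z).1 (ef z).
exact: cdiff_cont fd e0.
Qed.

Lemma seq_lower_bound (T : eqType) (s : seq T) (d : T -> R) :
  (forall x, x \in s -> 0 < d x) ->
  exists2 m, 0 < m & forall x, x \in s -> m <= d x.
Proof.
elim: s => [|x s IH] ds; first by exists 1.
have [|m m0 ms] := IH; first by move=> y ys; rewrite ds// inE ys orbT.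
exists (Num.min m (d x)); first by rewrite lt_min m0 ds// mem_head.
move=> y; rewrite inE => /orP[/eqP->|/ms my]; rewrite ge_min ?lexx ?orbT//.
by rewrite my.
Qed.

Lemma seq_upper_bound (T : eqType) (s : seq T) (d : T -> R) :
  exists2 m, 0 <= m & forall x, x \in s -> d x <= m.
Proof.
elim: s => [|x s [m m0 ms]]; first by exists 0.
exists (Num.max m (d x)); first by rewrite le_max m0.
by move=> y; rewrite inE => /orP[/eqP->|/ms ym]; rewrite le_max ?lexx ?orbT// ym.
Qed.

Lemma unif_cont_disc f r e : ccont f -> 0 < e ->
  exists2 t, 0 < t &
    forall z w, disc r z -> nm (w - z) < t -> nm (f w - f z) < e.
Proof.
move=> cf e0; have e20 : 0 < e / 2 by rewrite divr_gt0.
have /choice[d Hd] : forall x, exists t, 0 < t /\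
    forall w, nm (w - x) < t -> nm (f w - f x) < e / 2.
  by move=> x; have [t t0 Ht] := cf x _ e20; exists t.
have [x _|s _ Ks] :=
    compact_gauge (d := fun x => d x / 2) (compact_disc (r := r)).
  by rewrite divr_gt0//; case: (Hd x).
have [x _|t t0 ts] := @seq_lower_bound _ s (fun x => d x / 2).
  by rewrite divr_gt0//; case: (Hd x).
exists t => // z w /Ks[x xs zx] wz.
have [dx0 Hx] := Hd x.
have fz : nm (f z - f x) < e / 2 by apply: Hx; lra.
have fw : nm (f w - f x) < e / 2.
  by apply: Hx; apply: le_lt_trans (nmBD z _ _) _; have := ts _ xs; lra.
by apply: le_lt_trans (nmBD (f x) _ _) _; rewrite (nmB (f x)); lra.
Qed.

Lemma bounded_on_compact f (K : set C) : ccont f -> compact K ->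
  exists2 M, 0 <= M & forall z, K z -> nm (f z) <= M.
Proof.
move=> cf cK.
have /choice[d Hd] : forall x, exists t, 0 < t /\
    forall w, nm (w - x) < t -> nm (f w - f x) < 1.
  by move=> x; have [t t0 Ht] := cf x _ ltr01; exists t.
have [x _|s _ Ks] := compact_gauge (d := d) cK; first by case: (Hd x).
have [M M0 Ms] := @seq_upper_bound _ s (fun x => nm (f x)).
exists (M + 1) => [|z /Ks[x xs zx]]; first by rewrite addr_ge0.
have [_ Hx] := Hd x; have := Hx _ zx; have := Ms _ xs.
by have := nmD (f z - f x) (f x); rewrite subrK; lra.
Qed.

Lemma cvg_nm (x : nat -> C) (l : C) e : x @ \oo --> l -> 0 < e ->
  exists N, forall n, (N <= n)%N -> nm (x n - l) < e.
Proof.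
move=> xl e0; have /xl [N _ HN] : nbhs l [set w : C | nm (w - l) < e].
  by apply/nbhs_normcP; exists e.
by exists N => n Nn; exact: HN.
Qed.

Lemma cvg_nm_le (x : nat -> C) (l c : C) B : x @ \oo --> l ->
  (forall n, nm (x n - c) <= B) -> nm (l - c) <= B.
Proof.
move=> xl xB; apply/ler_addgt0Pr => e e0.
have [N HN] := cvg_nm xl e0.
have := nmBD (x N) l c; have := xB N; have := HN N (leqnn N).
by rewrite (nmB (x N) l); lra.
Qed.

Lemma half_pow_small (c e : R) : 0 < e -> exists n, c / 2 ^+ n < e.
Proof.
move=> e0; exists (Num.trunc (`|c| / e)).+1.
set n := (Num.trunc _).+1; have cn : `|c| / e < n%:R by exact: truncnS_gt.
have n2 : (n%:R : R) < 2 ^+ n by rewrite -natrX ltr_nat ltn_expl.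
rewrite ltr_pdivrMr ?exprn_gt0// mulrC -ltr_pdivrMr//.
apply: (lt_trans _ n2); apply: le_lt_trans cn.
by rewrite ler_pM2r ?invr_gt0// ler_norm.
Qed.

Lemma cauchy_seq_cvg (x : nat -> C) :
  (forall e, 0 < e -> exists N, forall n, (N <= n)%N -> nm (x n - x N) < e) ->
  cvg (x @ \oo).
Proof.
move=> Hx; apply: plane_cauchy_cvg => e /Hx[N HN]; exists (x N).
by exists N.
Qed.

Lemma geometric_cvg (x : nat -> C) c :
  (forall k, nm (x k.+1 - x k) <= c / 2 ^+ k) ->
  exists l : C, x @ \oo --> l /\ forall k, nm (l - x k) <= 2 * c / 2 ^+ k.
Proof.
move=> Hx.
have Hk k j : nm (x (j + k)%N - x k) <= 2 * c / 2 ^+ k - 2 * c / 2 ^+ (j + k).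
  elim: j => [|j IH]; first by rewrite !subrr nm0.
  rewrite addSn; apply: le_trans (nmBD (x (j + k)%N) _ _) _.
  have := Hx (j + k)%N; rewrite (exprS _ (j + k)).
  have p0 : (2 ^+ (j + k) : R) != 0 by rewrite expf_neq0.
  have -> : 2 * c / (2 * 2 ^+ (j + k)) = c / 2 ^+ (j + k) by field.
  have dbl : 2 * c / 2 ^+ (j + k) = c / 2 ^+ (j + k) + c / 2 ^+ (j + k) by field.
  rewrite dbl in IH.
  lra.
have c0 : 0 <= c by have := le_trans (nm_ge0 _) (Hx 0%N); rewrite expr0 divr1.
have Hk' k j : nm (x (j + k)%N - x k) <= 2 * c / 2 ^+ k.
  apply: le_trans (Hk k j) _.
  by rewrite lerBlDr lerDl !mulr_ge0// invr_ge0 exprn_ge0.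
have /cvg_ex[l xl] : cvg (x @ \oo).
  apply: cauchy_seq_cvg => e e0; have [N HN] := half_pow_small (2 * c) e0.
  by exists N => n /subnK <-; apply: le_lt_trans HN.
exists l; split=> // k; apply: (@cvg_nm_le (fun n => x (n + k)%N)) => //.
by rewrite cvg_shiftn.
Qed.

End Differentiation.

(** * Integration along segments *)
Section PathIntegral.
Variable R : realType.
Local Notation C := (Cplane R).
Implicit Types (a b c u v z w : C) (r e : R).

Definition midpoint a b : C := (a + b) / 2.

(** The midpoint rule on [2 ^ n] equal pieces of the segment from [a] to [b].
    This recursion makes additivity under bisection hold by definition, and
    evaluating at midpoints makes the sum odd under reversal of the segment and
    exact on affine functions. *)
Fixpoint dyadic_sum (f : C -> C) n a b : C :=
  if n is n'.+1 then
    dyadic_sum f n' a (midpoint a b) + dyadic_sum f n' (midpoint a b) b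
  else (b - a) * f (midpoint a b).

(** Convexity is needed at dyadic points only, since [dyadic_sum] evaluates [f]
    at iterated midpoints. *)
Definition midconvex (P : set C) :=
  forall u v, P u -> P v -> P (midpoint u v).

Lemma midpointC a b : midpoint a b = midpoint b a.
Proof. by rewrite /midpoint addrC. Qed.

Lemma nm_half z : nm (z / 2) = nm z / 2.
Proof. by rewrite nmM nmV nm_nat. Qed.

Lemma midpoint_ball z r : midconvex [set w | nm (w - z) <= r].
Proof.
move=> u v /= uz vz; rewrite (_ : _ - z = ((u - z) + (v - z)) / 2).
  by rewrite nm_half; have := nmD (u - z) (v - z); lra.
by rewrite /midpoint; field.
Qed.

Lemma midconvexI (P Q : set C) :
  midconvex P -> midconvex Q -> midconvex (P `&` Q).
Proof. by move=> HP HQ u v [Pu Qu] [Pv Qv]; split; [exact: HP | exact: HQ]. Qed.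

Lemma midconvex_disc r : midconvex (disc (R := R) r).
Proof.
move=> u v ru rv; have := @midpoint_ball 0 r u v.
by rewrite /disc /= !subr0; apply.
Qed.

Lemma nm_sub_midl a b : nm (midpoint a b - a) = nm (b - a) / 2.
Proof.
rewrite (_ : _ - a = (b - a) / 2) ?nm_half//.
by rewrite /midpoint; field.
Qed.

Lemma nm_sub_midr a b : nm (b - midpoint a b) = nm (b - a) / 2.
Proof.
rewrite (_ : b - _ = (b - a) / 2) ?nm_half//.
by rewrite /midpoint; field.
Qed.

Lemma dyadic_sumN f n a b : dyadic_sum f n b a = - dyadic_sum f n a b.
Proof.
elim: n a b => [|n IH] a b /=; first by rewrite (midpointC b a) -mulNr opprB.
by rewrite (midpointC b a) (IH a) (IH _ b) opprD addrC.
Qed.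

(** The midpoint rule is exact on affine functions, and the errors on the two
    halves of a segment add up in proportion to the lengths. *)
Lemma dyadic_sum_affine f (P : set C) (al be : C) e n a b :
  midconvex P -> (forall w, P w -> nm (f w - (al + be * w)) <= e) ->
  P a -> P b ->
  nm (dyadic_sum f n a b - (b - a) * (al + be * midpoint a b))
    <= e * nm (b - a).
Proof.
move=> mP fP; elim: n a b => [|n IH] a b Pa Pb /=.
  rewrite -mulrBr nmM mulrC ler_wpM2r ?nm_ge0//; apply: fP; exact: mP.
have Pm : P (midpoint a b) by exact: mP.
have -> : (b - a) * (al + be * midpoint a b) =
    (midpoint a b - a) * (al + be * midpoint a (midpoint a b)) +
    (b - midpoint a b) * (al + be * midpoint (midpoint a b) b).
  by rewrite /midpoint; field.
rewrite opprD addrACA; apply: le_trans (nmD _ _) _.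
have := IH _ _ Pa Pm; have := IH _ _ Pm Pb.
by rewrite nm_sub_midl nm_sub_midr; lra.
Qed.

(** Once the [2 ^ n] pieces are shorter than the modulus of continuity [t], [f]
    is nearly constant on each of them and further bisections change little. *)
Lemma dyadic_sum_cauchy f (P : set C) t e n k a b :
  midconvex P ->
  (forall u v, P u -> P v -> nm (u - v) <= t -> nm (f u - f v) <= e) ->
  P a -> P b -> nm (b - a) <= 2 ^+ n * t ->
  nm (dyadic_sum f (n + k) a b - dyadic_sum f n a b) <= e * nm (b - a).
Proof.
move=> mP uc; elim: n a b => [|n IH] a b Pa Pb.
  rewrite expr0 mul1r add0n => ab /=.
  have mid : nm (midpoint a b - a) <= t.
    by rewrite nm_sub_midl; have := nm_ge0 (b - a); lra.
  have mid' : nm (b - midpoint a b) <= t.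
    by rewrite nm_sub_midr; have := nm_ge0 (b - a); lra.
  have := @dyadic_sum_affine f (P `&` [set w | nm (w - midpoint a b) <= t])
    (f (midpoint a b)) 0 e k a b.
  rewrite mul0r addr0; apply => //.
  - by apply: midconvexI => //; exact: midpoint_ball.
  - by move=> w [Pw /= wm]; rewrite mul0r addr0; apply: uc => //; exact: mP.
  - by split => //=; rewrite nmB.
rewrite exprS -mulrA => ab.
have Pm : P (midpoint a b) by exact: mP.
rewrite addSn /= opprD addrACA; apply: le_trans (nmD _ _) _.
have := IH _ _ Pa Pm; have := IH _ _ Pm Pb.
rewrite nm_sub_midl nm_sub_midr; lra.
Qed.

Variable f : C -> C.
Hypothesis f_cont : ccont f.

Definition segint a b : C := lim (dyadic_sum f n a b @[n --> \oo]).

Lemma segint_cvg a b : dyadic_sum f n a b @[n --> \oo] --> segint a b.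
Proof.
apply: cauchy_seq_cvg => e e0.
pose r := Num.max (nm a) (nm b).
pose e' := e / (nm (b - a) + 1).
have ab0 : 0 < nm (b - a) + 1 by rewrite ltr_wpDl ?nm_ge0.
have e'0 : 0 < e' by rewrite divr_gt0.
have [t t0 Ht] := unif_cont_disc r f_cont e'0.
have t20 : 0 < t / 2 by rewrite divr_gt0.
have [n Hn] := half_pow_small (nm (b - a)) t20.
exists n => m /subnKC <-; apply: (@le_lt_trans _ _ (e' * nm (b - a))).
  apply: (@dyadic_sum_cauchy f (disc r) (t / 2)).
  - exact: midconvex_disc.
  - by move=> u v ru rv uv; apply/ltW/Ht => //; lra.
  - by rewrite /disc/= /r le_max lexx.
  - by rewrite /disc/= /r le_max lexx orbT.
  - by rewrite mulrC -ler_pdivrMr ?exprn_gt0// ltW.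
by rewrite /e' mulrAC ltr_pdivrMr// mulrDr mulr1 ltrDl.
Qed.

Lemma segintN a b : segint b a = - segint a b.
Proof.
apply: cvg_lim => //.
have -> : dyadic_sum f ^~ b ^~ a = \- (fun n => dyadic_sum f n a b).
  by apply/funext => n; exact: dyadic_sumN.
by apply: cvgN; exact: segint_cvg.
Qed.

Lemma segint_mid a b :
  segint a b = segint a (midpoint a b) + segint (midpoint a b) b.
Proof.
apply: cvg_lim => //; rewrite -(cvg_shiftS (fun n => dyadic_sum f n a b)) /=.
by apply: cvgD; exact: segint_cvg.
Qed.

Lemma segint_affine (P : set C) (al be : C) e a b :
  midconvex P -> (forall w, P w -> nm (f w - (al + be * w)) <= e) ->
  P a -> P b ->
  nm (segint a b - (b - a) * (al + be * midpoint a b)) <= e * nm (b - a).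
Proof.
move=> mP fP Pa Pb; apply: (cvg_nm_le (@segint_cvg a b)) => n.
exact: (dyadic_sum_affine _ mP fP).
Qed.

Lemma segint_cst (P : set C) (al : C) e a b :
  midconvex P -> (forall w, P w -> nm (f w - al) <= e) ->
  P a -> P b -> nm (segint a b - (b - a) * al) <= e * nm (b - a).
Proof.
move=> mP fP Pa Pb; have := @segint_affine P al 0 e a b mP.
by rewrite mul0r addr0; apply=> // w /fP; rewrite mul0r addr0.
Qed.

Definition triangle a b c := segint a b + segint b c + segint c a.

(** Each side of the medial triangle is run through in both directions, so only
    the outer boundary is left. *)
Lemma triangle_split a b c :
  let m1 := midpoint a b in let m2 := midpoint b c in let m3 := midpoint c a in
  triangle a b c = triangle a m1 m3 + triangle m1 b m2 + triangle m3 m2 c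
    + triangle m2 m3 m1.
Proof.
move=> m1 m2 m3; rewrite /triangle.
rewrite (segint_mid a b) (segint_mid b c) (segint_mid c a).
rewrite -/m1 -/m2 -/m3 (segintN m1 m3) (segintN m2 m1) (segintN m3 m2).
by ring.
Qed.

Definition diam_le a b c r :=
  [/\ nm (b - a) <= r, nm (c - b) <= r & nm (a - c) <= r].

(** By [triangle_split], one of the four half-size triangles carries at least a
    quarter of the integral. *)
Lemma triangle_next a b c r : diam_le a b c r ->
  exists p : C * C * C,
    [/\ diam_le p.1.1 p.1.2 p.2 (r / 2), nm (p.1.1 - a) <= r &
      nm (triangle a b c) / 4 <= nm (triangle p.1.1 p.1.2 p.2)].
Proof.
move=> [ab bc ca].
set m1 := midpoint a b; set m2 := midpoint b c; set m3 := midpoint c a.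
have h0 := nm_ge0 (b - a).
have m1a : nm (m1 - a) <= r / 2 by rewrite nm_sub_midl; lra.
have bm1 : nm (b - m1) <= r / 2 by rewrite nm_sub_midr; lra.
have m2b : nm (m2 - b) <= r / 2 by rewrite nm_sub_midl; lra.
have cm2 : nm (c - m2) <= r / 2 by rewrite nm_sub_midr; lra.
have m3c : nm (m3 - c) <= r / 2 by rewrite nm_sub_midl; lra.
have am3 : nm (a - m3) <= r / 2 by rewrite nm_sub_midr; lra.
have m32 : nm (m3 - m2) <= r / 2.
  have -> : m3 - m2 = (a - b) / 2 by rewrite /m3 /m2 /midpoint; field.
  by rewrite nm_half nmB; lra.
have m13 : nm (m1 - m3) <= r / 2.
  have -> : m1 - m3 = (b - c) / 2 by rewrite /m1 /m3 /midpoint; field.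
  by rewrite nm_half nmB; lra.
have m21 : nm (m2 - m1) <= r / 2.
  have -> : m2 - m1 = (c - a) / 2 by rewrite /m2 /m1 /midpoint; field.
  by rewrite nm_half nmB; lra.
have := triangle_split a b c; rewrite -/m1 -/m2 -/m3 /= => E.
set T1 := triangle a m1 m3 in E; set T2 := triangle m1 b m2 in E.
set T3 := triangle m3 m2 c in E; set T4 := triangle m2 m3 m1 in E.
have : nm (triangle a b c) <= nm T1 + nm T2 + nm T3 + nm T4.
  rewrite E; apply: le_trans (nmD _ _) _.
  by have := nmD (T1 + T2) T3; have := nmD T1 T2; lra.
set N := nm (triangle a b c) => EN.
have [H1|H1] := leP (N / 4) (nm T1).
  exists (a, m1, m3); split => //=; last by rewrite subrr nm0; lra.
  by split => //; rewrite nmB.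
have [H2|H2] := leP (N / 4) (nm T2).
  by exists (m1, b, m2); split => //=; [split => //; rewrite nmB|lra].
have [H3|H3] := leP (N / 4) (nm T3).
  exists (m3, m2, c); split => //=; last by rewrite nmB; lra.
  by split => //; rewrite nmB.
exists (m2, m3, m1); split => //=; last lra.
have := nmBD m1 m2 a; lra.
Qed.

End PathIntegral.

(** * Goursat's theorem and locally Lipschitz approximation *)
Section Goursat.
Variable R : realType.
Local Notation C := (Cplane R).
Implicit Types (a b c z w h : C) (r e : R) (f g : C -> C).

(** Goursat's argument: halved triangles that keep a quarter of the integral
    shrink to a point [l]; near [l] the function is affine up to
    [e * nm (w - l)], and affine functions have integral zero, so the [k]-th
    integral is at most a constant times [e / 4 ^ k] with [e] arbitrary. *)
Lemma triangle_eq0 f a b c : entire f -> triangle f a b c = 0.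
Proof.
move=> ef; have cf := entire_cont ef.
apply: contrapT => /eqP; rewrite -nm_gt0; set eta := nm _ => eta0.
pose ok (x : C * C * C * R) (q : C * C * C) :=
  diam_le x.1.1.1 x.1.1.2 x.1.2 x.2 ->
    [/\ diam_le q.1.1 q.1.2 q.2 (x.2 / 2), nm (q.1.1 - x.1.1.1) <= x.2 &
     nm (triangle f x.1.1.1 x.1.1.2 x.1.2) / 4
       <= nm (triangle f q.1.1 q.1.2 q.2)].
have /choice[next Hnext] : forall x, exists q, ok x q.
  move=> x; have [/(triangle_next cf)[q Hq]|nd] :=
    pselect (diam_le x.1.1.1 x.1.1.2 x.1.2 x.2); first by exists q.
  by exists x.1 => /nd.
pose d := nm (b - a) + nm (c - b) + nm (a - c) + 1.
have d0 : 0 < d by rewrite /d ltr_wpDl// !addr_ge0 ?nm_ge0.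
pose s k := iter k (fun x => (next x, x.2 / 2)) (a, b, c, d).
have s2 k : (s k).2 = d / 2 ^+ k.
  elim: k => [|k IH]; first by rewrite expr0 divr1.
  by rewrite /s iterS -/(s k) /= IH exprSr invfM mulrA.
have sdiam k : diam_le (s k).1.1.1 (s k).1.1.2 (s k).1.2 (s k).2.
  elim: k => [|k IH]; last by have [] := Hnext _ IH.
  rewrite /s /= /diam_le /d; have := nm_ge0 (b - a); have := nm_ge0 (c - b).
  by have := nm_ge0 (a - c); split; lra.
have stri k : eta / 4 ^+ k <= nm (triangle f (s k).1.1.1 (s k).1.1.2 (s k).1.2).
  elim: k => [|k IH]; first by rewrite expr0 divr1.
  have [_ _] := Hnext _ (sdiam k); rewrite /s iterS -/(s k) /=; apply: le_trans.
  by rewrite exprSr invfM mulrA ler_pM2r.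
have sstep k : nm ((s k.+1).1.1.1 - (s k).1.1.1) <= d / 2 ^+ k.
  by have [_ + _] := Hnext _ (sdiam k); rewrite s2.
have [l [_ Hl]] := geometric_cvg sstep.
have [D fD] := (derivable_cdiff f l).1 (ef l).
(* The vertices of the k-th triangle are within 3 d / 2^k of l and its sides
   have length at most d / 2^k, so its integral is at most 9 e d^2 / 4^k; this
   choice of e makes that half of eta / 4^k. *)
pose e := eta / (18 * d ^+ 2).
have e0 : 0 < e by rewrite divr_gt0// mulr_gt0// exprn_gt0.
have [t t0 Ht] := fD _ e0.
have [k Hk] := half_pow_small (3 * d) t0.
move: (Hl k) (sdiam k) (stri k); rewrite s2.
set a' := (s k).1.1.1; set b' := (s k).1.1.2; set c' := (s k).1.2.
set q := 2 ^+ k; have q0 : 0 < q :> R by rewrite exprn_gt0.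
have -> : 4 ^+ k = q ^+ 2 :> R.
  by rewrite /q -exprM mulnC exprM; congr (_ ^+ _); rewrite expr2; ring.
rewrite -(mulrA 2 d); rewrite -/q -(mulrA 3 d) in Hk.
set rho := d / q in Hk *; have Hk' : 3 * rho < t by [].
have rho0 : 0 < rho by rewrite divr_gt0.
move=> la [ab bc ca] tri.
pose P : set C := [set w | nm (w - l) <= 3 * rho].
have mP : midconvex P by exact: midpoint_ball.
have fP w : P w -> nm (f w - (f l - D * l + D * w)) <= e * (3 * rho).
  move=> Pw; rewrite (_ : _ - _ = f w - f l - D * (w - l)); last by ring.
  apply: le_trans (Ht _ (le_lt_trans Pw Hk')) _.
  by rewrite ler_pM2l.
have Pa : P a' by rewrite /P/= nmB; lra.
have Pb : P b' by rewrite /P/=; have := nmBD a' b' l; rewrite (nmB a' l); lra.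
have Pc : P c'.
  by rewrite /P/=; have := nmBD a' c' l; rewrite (nmB a' l) (nmB c' a'); lra.
have I1 := segint_affine cf mP fP Pa Pb.
have I2 := segint_affine cf mP fP Pb Pc.
have I3 := segint_affine cf mP fP Pc Pa.
have : nm (triangle f a' b' c') <= 9 * e * rho ^+ 2.
  have -> : triangle f a' b' c' =
    (segint f a' b' - (b' - a') * (f l - D * l + D * midpoint a' b')) +
    (segint f b' c' - (c' - b') * (f l - D * l + D * midpoint b' c')) +
    (segint f c' a' - (a' - c') * (f l - D * l + D * midpoint c' a')).
    by rewrite /triangle /midpoint; field.
  apply: le_trans (nmD _ _) _; apply: le_trans (lerD (nmD _ _) (lexx _)) _.
  have er0 : 0 < e * (3 * rho) by apply: mulr_gt0 => //; apply: mulr_gt0.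
  have := ler_wpM2l (ltW er0) ab; have := ler_wpM2l (ltW er0) bc.
  by have := ler_wpM2l (ltW er0) ca; lra.
have -> : 9 * e * rho ^+ 2 = (eta / q ^+ 2) / 2.
  by rewrite /e /rho; field; rewrite !gt_eqF.
have : 0 < eta / q ^+ 2 by rewrite divr_gt0// exprn_gt0.
lra.
Qed.

Lemma segint_primitive f z w : entire f ->
  segint f 0 w - segint f 0 z = segint f z w.
Proof.
move=> ef; have := triangle_eq0 0 z w ef; rewrite /triangle.
rewrite (segintN (entire_cont ef) 0 w) => /eqP.
rewrite addr_eq0 opprK => /eqP <-.
by rewrite addrC addKr.
Qed.

Definition loclip g := forall r, exists2 M, 0 <= M &
  forall z w, disc r z -> disc r w -> nm (g z - g w) <= M * nm (z - w).

(** The class in which corrections are made; see [close_C1] for the reason why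
    Lipschitz constants must be available. *)
Definition tame g := entire g /\ loclip g.

(** With a primitive [F] of [f] the average is [(F (z + h) - F z) / h], hence
    differentiable; it is locally Lipschitz because its increment from [w] to [z]
    is, up to [1 / h], the difference of the integrals of [f] over the segments
    from [w + h] to [z + h] and from [w] to [z]. *)
Lemma segint_average_tame f h : entire f -> h != 0 ->
  tame (fun z => segint f z (z + h) / h).
Proof.
move=> ef h0; have cf := entire_cont ef; split.
  move=> z; apply/derivable_cdiff; exists ((f (z + h) - f z) / h) => e e0.
  have h0' : 0 < nm h by rewrite nm_gt0.
  pose e' := e * nm h / 2.
  have e'0 : 0 < e' by rewrite divr_gt0// mulr_gt0.
  have [t1 t10 H1] := cf z _ e'0; have [t2 t20 H2] := cf (z + h) _ e'0.
  exists (Num.min t1 t2); first by rewrite lt_min t10.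
  move=> w; rewrite lt_min => /andP[w1 w2].
  have small x t : (forall y, nm (y - x) < t -> nm (f y - f x) < e') ->
      nm (w - z) < t ->
      nm (segint f x (x + (w - z)) - (w - z) * f x) <= e' * nm (w - z).
    move=> Hx wt; have := @segint_cst _ _ cf
      [set y | nm (y - x) <= nm (w - z)] (f x) e' x (x + (w - z)).
    rewrite [x + _ - x]addrC addKr; apply => /=.
    - exact: midpoint_ball.
    - by move=> y /= yx; apply/ltW/Hx/(le_lt_trans yx).
    - by rewrite subrr nm0 nm_ge0.
    - by rewrite addrC addKr.
  have S1 := small _ _ H1 w1; have S2 := small _ _ H2 w2.
  have E1 : z + (w - z) = w by ring.
  have E2 : z + h + (w - z) = w + h by ring.
  rewrite E1 in S1; rewrite E2 in S2.
  rewrite -(segint_primitive z w ef) in S1.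
  rewrite -(segint_primitive (z + h) (w + h) ef) in S2.
  rewrite -(segint_primitive z (z + h) ef) -(segint_primitive w (w + h) ef).
  set F := segint f 0 in S1 S2 *.
  rewrite (_ : _ - _ = ((F (w + h) - F (z + h) - (w - z) * f (z + h))
     - (F w - F z - (w - z) * f z)) / h); last by field.
  rewrite nmM nmV ler_pdivrMr//; apply: le_trans (nmD _ _) _; rewrite nmN.
  by rewrite /e' in S1 S2; lra.
move=> r.
have [M M0 HM] := bounded_on_compact cf (@compact_disc R (r + nm h)).
exists (2 * M / nm h); first by rewrite !mulr_ge0// invr_ge0 nm_ge0.
have bnd x y : disc (r + nm h) x -> disc (r + nm h) y ->
    nm (segint f x y) <= M * nm (y - x).
  move=> rx ry; have := @segint_cst _ _ cf (disc (r + nm h)) 0 M x y.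
  rewrite mulr0 subr0; apply => //; first exact: midconvex_disc.
  by move=> w rw; rewrite subr0; exact: HM.
move=> z w rz rw.
have rz' : disc (r + nm h) (z + h) by apply: le_trans (nmD _ _) _; rewrite lerD2r.
have rw' : disc (r + nm h) (w + h) by apply: le_trans (nmD _ _) _; rewrite lerD2r.
have rz1 : disc (r + nm h) z by apply: disc_le rz; rewrite lerDl nm_ge0.
have rw1 : disc (r + nm h) w by apply: disc_le rw; rewrite lerDl nm_ge0.
have B1 := bnd _ _ rw' rz'; have B2 := bnd _ _ rw1 rz1.
rewrite (_ : z + h - (w + h) = z - w) in B1; last by ring.
rewrite -(segint_primitive (w + h) (z + h) ef) in B1.
rewrite -(segint_primitive w z ef) in B2.
rewrite -(segint_primitive z (z + h) ef) -(segint_primitive w (w + h) ef).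
set F := segint f 0 in B1 B2 *.
rewrite (_ : _ - _ = ((F (z + h) - F (w + h)) - (F z - F w)) / h); last by field.
rewrite nmM nmV mulrAC ler_wpM2r ?invr_ge0 ?nm_ge0//.
by apply: le_trans (nmD _ _) _; rewrite nmN; lra.
Qed.

(** The average over a short segment differs from [f z] by at most the
    oscillation of [f] there. *)
Lemma tame_approx f r e : entire f -> 0 < e ->
  exists2 g, tame g & forall z, disc r z -> nm (g z - f z) <= e.
Proof.
move=> ef e0; have cf := entire_cont ef.
have [t t0 Ht] := unif_cont_disc r cf e0.
pose h : C := ((t / 2)%:C)%C.
have nh : nm h = t / 2 by rewrite /h nm_real gtr0_norm// divr_gt0.
have h0' : 0 < nm h by rewrite nh divr_gt0.
have h0 : h != 0 by rewrite -nm_gt0.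
clearbody h.
exists (fun z => segint f z (z + h) / h); first exact: segint_average_tame.
move=> z rz.
rewrite (_ : _ - _ = (segint f z (z + h) - h * f z) / h); last by field.
rewrite nmM nmV ler_pdivrMr//.
have := @segint_cst _ _ cf [set y | nm (y - z) <= nm h] (f z) e z (z + h).
rewrite [z + _ - z]addrC addKr; apply => /=.
- exact: midpoint_ball.
- by move=> y /= yz; apply/ltW/Ht => //; apply: le_lt_trans yz _; rewrite nh; lra.
- by rewrite subrr nm0 nm_ge0.
- by rewrite addrC addKr.
Qed.

End Goursat.

(** * Bumps and the one-step construction *)
Section Tame.
Variable R : realType.
Local Notation C := (Cplane R).
Implicit Types (a b c z w h : C) (r e : R) (f g : C -> C).

Lemma loclip_bounded g r : loclip g ->
  exists2 M, 0 <= M & forall z, disc r z -> nm (g z) <= M.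
Proof.
move=> /(_ r)[M M0 HM]; exists (nm (g 0) + M * `|r|).
  by rewrite addr_ge0 ?nm_ge0 ?mulr_ge0.
move=> z rz; have r0 : 0 <= r := le_trans (nm_ge0 z) rz.
have d0 : disc r 0 by rewrite /disc /mkset nm0.
have := HM _ _ rz d0; rewrite subr0 (ger0_norm r0) => H.
have := nmD (g z - g 0) (g 0); rewrite subrK.
have := ler_wpM2l M0 rz; lra.
Qed.

Lemma tame_cst c : tame (fun=> c).
Proof.
split=> [z|r]; first exact: derivable_cst.
by exists 0 => // z w _ _; rewrite subrr nm0 mul0r.
Qed.

Lemma tame_id : tame (fun z => z).
Proof.
split=> [z|r]; first exact: derivable_id.
by exists 1 => // z w _ _; rewrite mul1r.
Qed.

Lemma tameD f g : tame f -> tame g -> tame (fun z => f z + g z).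
Proof.
move=> [ef lf] [eg lg]; split=> [z|r]; first by apply: derivableD.
have [M M0 HM] := lf r; have [N N0 HN] := lg r.
exists (M + N); first by rewrite addr_ge0.
move=> z w rz rw; rewrite (_ : _ - _ = (f z - f w) + (g z - g w)); last by ring.
by apply: le_trans (nmD _ _) _; rewrite mulrDl lerD// ?HM// HN.
Qed.

(** The Lipschitz constant of a product, from bounds and Lipschitz constants
    of the factors. *)
Lemma nm_subM (x x' y y' : C) A B A' B' d :
  nm (x - x') <= A' * d -> nm (y - y') <= B' * d -> nm x <= A -> nm y' <= B ->
  0 <= d ->  0 <= A' -> 0 <= B' ->
  nm (x * y - x' * y') <= (A * B' + A' * B) * d.
Proof.
move=> xx yy xA yB d0 A0 B0.
rewrite (_ : _ - _ = x * (y - y') + (x - x') * y'); last by ring.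
apply: le_trans (nmD _ _) _; rewrite !nmM mulrDl; apply: lerD.
  by rewrite -mulrA; apply: ler_pM => //; exact: nm_ge0.
by rewrite mulrAC; apply: ler_pM => //; exact: nm_ge0.
Qed.

Lemma tameM f g : tame f -> tame g -> tame (fun z => f z * g z).
Proof.
move=> [ef lf] [eg lg]; split=> [z|r].
  exact: (@derivableM _ _ (f : C -> R[i]) (g : C -> R[i])).
have [M M0 HM] := lf r; have [N N0 HN] := lg r.
have [A A0 HA] := loclip_bounded r lf; have [B B0 HB] := loclip_bounded r lg.
exists (A * N + M * B); first by rewrite addr_ge0// mulr_ge0.
by move=> z w rz rw; apply: nm_subM; rewrite ?nm_ge0 ?HM ?HN ?HA ?HB.
Qed.

Lemma tameN f : tame f -> tame (fun z => - f z).
Proof.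
move=> tf; have -> : (fun z => - f z) = (fun z => -1 * f z).
  by apply/funext => z; rewrite mulN1r.
by apply: tameM => //; exact: tame_cst.
Qed.

Lemma entire_shift f c : entire f -> entire (fun z => f (z + c)).
Proof.
move=> ef z; apply/derivable_cdiff.
have [d fd] := (derivable_cdiff f (z + c)).1 (ef _).
exists d => e /fd[t t0 Ht]; exists t => // w.
have -> : w - z = w + c - (z + c) by ring.
exact: Ht.
Qed.

Lemma tame_shift f c : tame f -> tame (fun z => f (z + c)).
Proof.
move=> [ef lf]; split=> [|r]; first exact: entire_shift.
have [M M0 HM] := lf (r + nm c); exists M => // z w rz rw.
rewrite (_ : z - w = z + c - (w + c)); last by ring.
by apply: HM; apply: le_trans (nmD _ _) _; rewrite lerD2r.
Qed.

Lemma tame_prod (I : Type) (s : seq I) (P : pred I) (F : I -> C -> C) :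
  (forall i, P i -> tame (F i)) -> tame (fun z => \prod_(i <- s | P i) F i z).
Proof.
move=> tF; elim: s => [|i s IH].
  under eq_fun do rewrite big_nil; exact: tame_cst.
under eq_fun do rewrite big_cons.
by case: (boolP (P i)) => Pi //; apply: tameM IH; exact: tF.
Qed.

Lemma tame_sum (I : Type) (s : seq I) (F : I -> C -> C) :
  (forall i, tame (F i)) -> tame (fun z => \sum_(i <- s) F i z).
Proof.
move=> tF; elim: s => [|i s IH].
  by under eq_fun do rewrite big_nil; exact: tame_cst.
by under eq_fun do rewrite big_cons; exact: tameD.
Qed.

(** The cubic with [0] and [1] as critical fixed points: close to [0] and [1] it
    contracts by a factor 2, so its iterates turn approximate values [0], [1]
    into arbitrarily accurate ones. *)
Definition sharpen w : C := 3 * w ^+ 2 - 2 * w ^+ 3.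

Lemma tame_sharpen f n : tame f -> tame (fun z => iter n sharpen (f z)).
Proof.
move=> tf; elim: n => [//|n]; set g := (fun z : C => iter n _ _) => IH.
have -> : (fun z => iter n.+1 sharpen (f z)) =
    (fun z => 3 * (g z * g z) + - (2 * (g z * (g z * g z)))).
  by apply/funext => z; rewrite iterS /sharpen -/(g z); ring.
have gg := tameM IH IH.
exact: tameD (tameM (tame_cst 3) gg) (tameN (tameM (tame_cst 2) (tameM IH gg))).
Qed.

Lemma sharpen_lip z w : nm z <= 16^-1 -> nm w <= 16^-1 ->
  nm (sharpen z - sharpen w) <= nm (z - w) / 2.
Proof.
move=> z16 w16.
have -> : sharpen z - sharpen w =
    (z - w) * (3 * (z + w) - 2 * (z * z + z * w + w * w)).
  by rewrite /sharpen; ring.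
rewrite nmM ler_wpM2l ?nm_ge0//.
apply: le_trans (nmD _ _) _; rewrite nmN !nmM !nm_nat.
have := nmD z w; have := nmD (z * z + z * w) (w * w); have := nmD (z * z) (z * w).
rewrite !nmM; have := nm_ge0 z; have := nm_ge0 w => w0 z0.
have : nm z * nm z <= 16^-1 * 16^-1 by apply: ler_pM.
have : nm z * nm w <= 16^-1 * 16^-1 by apply: ler_pM.
have : nm w * nm w <= 16^-1 * 16^-1 by apply: ler_pM.
lra.
Qed.

Lemma sharpen0 : sharpen 0 = 0.
Proof. by rewrite /sharpen; ring. Qed.

Lemma iter_sharpen0 n : iter n sharpen 0 = 0.
Proof. by elim: n => //= n ->; exact: sharpen0. Qed.

Lemma iter_sharpen_lip n z w : nm z <= 16^-1 -> nm w <= 16^-1 ->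
  nm (iter n sharpen z - iter n sharpen w) <= nm (z - w) / 2 ^+ n.
Proof.
have small u k : nm u <= 16^-1 -> nm (iter k sharpen u) <= 16^-1.
  move=> u16; elim: k => //= k IH.
  have := @sharpen_lip (iter k sharpen u) 0 IH; rewrite sharpen0 nm0 !subr0.
  have := nm_ge0 (iter k sharpen u); lra.
move=> z16 w16; elim: n => [|n IH]; first by rewrite expr0 divr1.
rewrite !iterS; apply: le_trans (sharpen_lip (small _ _ z16) (small _ _ w16)) _.
by rewrite exprSr invfM mulrA ler_pM2r.
Qed.

(** The symmetry [w -> 1 - w] transports estimates near [0] to estimates
    near [1]. *)
Lemma iter_sharpenC n w : iter n sharpen (1 - w) = 1 - iter n sharpen w.
Proof. by elim: n => //= n ->; rewrite /sharpen; ring. Qed.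

Lemma iter_sharpen_small n w : nm w <= 16^-1 -> nm (iter n sharpen w) <= 2 ^- n.
Proof.
move=> w16; have := @iter_sharpen_lip n w 0 w16.
rewrite iter_sharpen0 nm0 !subr0 => H; apply: le_trans (H _) _; first lra.
by rewrite ler_piMl ?invr_ge0 ?exprn_ge0//; lra.
Qed.

(** Lagrange interpolation in the variable [z / mu], sharpened. The radius [rho]
    depends on the nodes only, so that the discs around [mu * x j] may grow
    in proportion to [mu] while [e] is chosen afterwards: the functions that the
    bumps multiply are bounded only once [mu] is known. *)
Lemma exists_bump (I : finType) (x : I -> C) : injective x ->
  exists2 rho, 0 < rho & forall mu, mu != 0 -> forall k e, 0 < e ->
    exists phi, [/\ tame phi,
      forall j z, nm (z - mu * x j) <= rho * nm mu ->
        nm (phi z - (j == k)%:R) <= e &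
      forall j z w, j != k -> nm (z - mu * x j) <= rho * nm mu ->
        nm (w - mu * x j) <= rho * nm mu ->
        nm (phi z - phi w) <= e * nm (z - w)].
Proof.
move=> x_inj.
pose L k w := \prod_(j | j != k) ((w - x j) * (x k - x j)^-1).
have Ltame k c : tame (fun z => L k (z * c)).
  apply: tame_prod => j jk; apply: tameM; last exact: tame_cst.
  by apply: tameD; [apply: tameM; [exact: tame_id|exact: tame_cst]|exact: tame_cst].
have Lnode k j : L k (x j) = (j == k)%:R.
  rewrite /L; have [->|jk] := eqVneq j k.
    by rewrite big1// => i ik; rewrite divff// subr_eq0 (inj_eq x_inj) eq_sym.
  by rewrite (bigD1 j)//= subrr !mul0r.
have Lcont k j : exists t, 0 < t /\
    forall w, nm (w - x j) < t -> nm (L k w - (j == k)%:R) < 16^-1.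
  have [eL _] := Ltame k 1.
  have c16 : 0 < 16^-1 :> R by rewrite invr_gt0.
  have [t t0 Ht] := entire_cont eL (x j) c16.
  exists t; split=> // w /Ht; by rewrite !mulr1 Lnode.
have /choice[t Ht] : forall p : I * I, exists t, 0 < t /\
    forall w, nm (w - x p.2) < t -> nm (L p.1 w - (p.2 == p.1)%:R) < 16^-1.
  by move=> [k j]; exact: Lcont.
have [|rho rho0 Hrho] := @seq_lower_bound R _ (enum [set: I * I]%SET) t.
  by move=> p _; case: (Ht p).
exists (rho / 2); first by rewrite divr_gt0.
move=> mu mu0 k e e0.
have nmu : 0 < nm mu by rewrite nm_gt0.
have Lclose j z : nm (z - mu * x j) <= rho / 2 * nm mu ->
    nm (L k (z * mu^-1) - (j == k)%:R) <= 16^-1.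
  move=> zj; have [_ Hk] := Ht (k, j); apply/ltW/Hk => /=.
  have -> : z * mu^-1 - x j = (z - mu * x j) * mu^-1 by field.
  rewrite nmM nmV ltr_pdivrMr//; apply: le_lt_trans zj _; rewrite ltr_pM2r//.
  by apply: (@lt_le_trans _ _ rho); [lra|apply: Hrho; rewrite mem_enum inE].
have tL := Ltame k mu^-1.
have [B B0 HB] : exists2 B, 0 <= B & forall j, nm (mu * x j) + rho / 2 * nm mu <= B.
  have [B B0 HB] := @seq_upper_bound R _ (enum I)
    (fun j => nm (mu * x j) + rho / 2 * nm mu).
  by exists B => // j; apply: HB; rewrite mem_enum.
have inB j z : nm (z - mu * x j) <= rho / 2 * nm mu -> disc B z.
  move=> zj; apply: le_trans (HB j); have := nmD (z - mu * x j) (mu * x j).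
  by rewrite subrK; lra.
have [M M0 HM] := tL.2 B.
have [n Hn] := half_pow_small (M + 1) e0.
have n1 : 2 ^- n <= e.
  apply: le_trans (ltW Hn); rewrite -[leLHS]mul1r ler_wpM2r ?invr_ge0 ?exprn_ge0//.
  lra.
exists (fun z => iter n sharpen (L k (z * mu^-1))); split.
- exact: tame_sharpen.
- move=> j z zj; have := Lclose _ _ zj; have [_|_] := eqVneq j k => H.
    apply: le_trans n1; rewrite nmB -iter_sharpenC.
    by apply: iter_sharpen_small; rewrite nmB.
  by apply: le_trans n1; rewrite !subr0 in H *; exact: iter_sharpen_small.
- move=> j z w /negbTE jk zj wj.
  have := Lclose _ _ zj; have := Lclose _ _ wj; rewrite jk !subr0 => Hw Hz.
  apply: le_trans (iter_sharpen_lip n Hz Hw) _.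
  apply: (@le_trans _ _ (M * nm (z - w) / 2 ^+ n)).
    rewrite ler_wpM2r ?invr_ge0 ?exprn_ge0//.
    by apply: HM; [exact: inB zj|exact: inB wj].
  rewrite mulrAC ler_wpM2r ?nm_ge0//; apply: le_trans (ltW Hn).
  by rewrite ler_wpM2r ?invr_ge0 ?exprn_ge0//; lra.
Qed.

Lemma nm_sum_le n (F : 'I_n -> C) B : (forall i, nm (F i) <= B) ->
  nm (\sum_i F i) <= n%:R * B.
Proof.
move=> FB; elim: n F FB => [|n IH] F FB; first by rewrite big_ord0 nm0 mul0r.
rewrite big_ord_recr /=; apply: le_trans (nmD _ _) _.
by rewrite -natr1 mulrDl mul1r lerD// IH.
Qed.

(** The correction [\sum_l phi l * h l], with [h l z = p (z - c l) - u z], is small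
    around [0], where every [phi l] is, and close to [h l] around [c l]. *)
Lemma universal_step (d : nat) (x : 'I_d -> C) (m : nat -> C) u p r e :
  injective x -> (forall l, x l != 0) -> (forall B, exists s, B < nm (m s)) ->
  tame u -> tame p -> 0 < e ->
  exists v s, [/\ tame v,
    forall z, disc r z -> nm (v z - u z) <= e,
    forall z w, disc r z -> disc r w ->
      nm ((v z - u z) - (v w - u w)) <= e * nm (z - w) &
    forall l z, disc r z -> nm (v (z + m s * x l) - p z) <= e].
Proof.
move=> x_inj x0 m_unb tu tp e0.
(* None stands for the node 0, around which u must not be disturbed. *)
pose y (o : option 'I_d) := if o is Some l then x l else 0.
have y_inj : injective y.
  move=> [k|] [l|] //=; first by move=> /x_inj ->.
    by move/eqP; rewrite (negbTE (x0 k)).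
  by move=> /esym/eqP; rewrite (negbTE (x0 l)).
have [rho rho0 Hrho] := exists_bump y_inj.
have [s Hs] := m_unb (Num.max 0 (r / rho)).
move: Hs; rewrite gt_max => /andP[ms0 msr].
set mu := m s in ms0 msr *; have mu0 : mu != 0 by rewrite -nm_gt0.
have r_small : r <= rho * nm mu by rewrite mulrC -ler_pdivrMr// ltW.
pose h l z := p (z + - (mu * x l)) - u z.
have th l : tame (h l) by apply: tameD; [exact: tame_shift|exact: tameN].
have [B B0 HB] : exists2 B, 0 <= B & forall l, nm (mu * x l) + r <= B.
  have [B B0 HB] := @seq_upper_bound R _ (enum 'I_d) (fun l => nm (mu * x l) + r).
  by exists B => // l; apply: HB; rewrite mem_enum.
pose B' := Num.max B r.
have /choice[H HH] : forall l, exists M, [/\ 0 <= M,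
     forall z, disc B' z -> nm (h l z) <= M &
     forall z w, disc B' z -> disc B' w -> nm (h l z - h l w) <= M * nm (z - w)].
  move=> l; have [M M0 HM] := (th l).2 B'.
  have [N N0 HN] := loclip_bounded B' (th l).2.
  exists (M + N); split; first by rewrite addr_ge0.
    by move=> z /HN zN; rewrite (le_trans zN)// lerDr.
  move=> z w bz bw; rewrite (le_trans (HM _ _ bz bw))//.
  by rewrite ler_wpM2r ?nm_ge0// lerDl.
have [K K0 HK] : exists2 K, 0 <= K & forall l, H l <= K.
  have [K K0 HK] := @seq_upper_bound R _ (enum 'I_d) H.
  by exists K => // l; apply: HK; rewrite mem_enum.
pose eps := e / (d.+1%:R * (2 * K + 1)).
have K1 : 0 < 2 * K + 1 by lra.
have eps0 : 0 < eps by rewrite divr_gt0// mulr_gt0.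
have sum_eps : d%:R * (eps * (2 * K)) <= e.
  rewrite /eps (_ : _ * _ = e * ((d%:R / d.+1%:R) * (2 * K / (2 * K + 1)))).
    rewrite ler_piMr ?(ltW e0)// mulr_ile1 ?divr_ge0 ?mulr_ge0 ?(ltW K1)//.
      by rewrite ler_pdivrMr// mul1r ler_nat.
    by rewrite ler_pdivrMr// mul1r lerDl.
  by field; rewrite !gt_eqF//.
have /choice[phi Hphi] := fun l : 'I_d => Hrho mu mu0 (Some l) eps eps0.
exists (fun z => u z + \sum_l phi l z * h l z), s.
have near0 z : disc r z -> nm (z - mu * y None) <= rho * nm mu.
  by move=> rz; rewrite mulr0 subr0; exact: le_trans rz r_small.
have rB' z : disc r z -> disc B' z.
  by apply: disc_le; rewrite /B' le_max lexx orbT.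
split.
- apply: tameD => //; apply: tame_sum => l; apply: tameM => //.
  by have [] := Hphi l.
- move=> z rz; rewrite addrC addKr; apply: le_trans sum_eps.
  apply: nm_sum_le => l; have [_ Hp _] := Hphi l.
  have := Hp None z (near0 _ rz); rewrite subr0 => phil.
  have [H0 Hb _] := HH l; rewrite nmM; apply: ler_pM; rewrite ?nm_ge0//.
  by have := Hb _ (rB' _ rz); have := HK l; lra.
- move=> z w rz rw; rewrite ![u _ + _]addrC !addrK -sumrB.
  apply: le_trans (ler_wpM2r (nm_ge0 _) sum_eps); rewrite -mulrA.
  apply: nm_sum_le => l; have [_ Hp Hl] := Hphi l.
  have := Hp None z (near0 _ rz); rewrite subr0 => phil.
  have := Hl None z w isT (near0 _ rz) (near0 _ rw) => phill.
  have [H0 Hb HbL] := HH l.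
  have hl : nm (h l z - h l w) <= K * nm (z - w).
    apply: le_trans (HbL _ _ (rB' _ rz) (rB' _ rw)) _.
    by rewrite ler_wpM2r ?nm_ge0.
  have hb : nm (h l w) <= K := le_trans (Hb _ (rB' _ rw)) (HK l).
  apply: le_trans (nm_subM phill hl phil hb _ _ _) _; rewrite ?nm_ge0 ?(ltW eps0)//.
  by rewrite ler_wpM2r ?nm_ge0//; lra.
- move=> l0 z rz; set q := z + mu * x l0.
  have E : u q + \sum_l phi l q * h l q - p z =
      \sum_l (phi l q - (Some l0 == Some l)%:R) * h l q.
    have D : \sum_l (Some l0 == Some l)%:R * h l q = h l0 q.
      rewrite (bigD1 l0)//= eqxx mul1r big1 ?addr0// => l ll0.
      by rewrite (inj_eq Some_inj) eq_sym (negbTE ll0) mul0r.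
    under [RHS]eq_bigr do rewrite mulrBl.
    rewrite sumrB D.
    by rewrite /h /q addrK; ring.
  rewrite E; apply: le_trans sum_eps; apply: nm_sum_le => l.
  have [_ Hp _] := Hphi l; have [H0 Hb _] := HH l.
  have qn : nm (q - mu * y (Some l0)) <= rho * nm mu.
    by rewrite /q /= addrK; exact: le_trans rz r_small.
  have qB : disc B' q.
    have := HB l0; rewrite /disc/= /B' le_max => Hq; apply/orP; left.
    by have := nmD z (mu * x l0); rewrite /disc/= in rz; rewrite -/q; lra.
  rewrite nmM; apply: ler_pM; rewrite ?nm_ge0//; first exact: Hp qn.
  by have := Hb _ qB; have := HK l; lra.
Qed.

End Tame.

(** * Limits and a category argument for entire functions *)
Section Limits.
Variable R : realType.
Local Notation C := (Cplane R).
Implicit Types (z w h : C) (r e : R) (f g u v : C -> C).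

(** Closeness of values alone would not let differentiability pass to limits;
    the Lipschitz bound controls difference quotients. *)
Definition close_C1 r e u v :=
  (forall z, disc r z -> nm (v z - u z) <= e) /\
  (forall z w, disc r z -> disc r w ->
     nm ((v z - u z) - (v w - u w)) <= e * nm (z - w)).

Lemma geometric_cvg_shift (x : nat -> C) c k :
  (forall j, nm (x (j + k).+1 - x (j + k)%N) <= c / 2 ^+ j) ->
  exists2 l : C, x @ \oo --> l & nm (l - x k) <= 2 * c.
Proof.
move=> /(@geometric_cvg _ (fun j => x (j + k)%N))[l [xl Hl]].
exists l; first by rewrite -(cvg_shiftn k).
by have := Hl 0%N; rewrite expr0 divr1 add0n.
Qed.

Lemma geometric_lim (x : nat -> C) (l : C) c k : x @ \oo --> l ->
  (forall j, nm (x (j + k).+1 - x (j + k)%N) <= c / 2 ^+ j) ->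
  nm (l - x k) <= 2 * c.
Proof.
move=> xl /geometric_cvg_shift[l' xl' Hl'].
apply/ler_addgt0Pr => d d0; have d20 : 0 < d / 2 by rewrite divr_gt0.
have [N HN] := cvg_nm xl d20; have [M HM] := cvg_nm xl' d20.
have H1 := HN (N + M)%N (leq_addr _ _); have H2 := HM (N + M)%N (leq_addl _ _).
have := nmBD l' l (x k); have := nmBD (x (N + M)%N) l l'.
by rewrite (nmB l (x _)); lra.
Qed.

Section TameLimit.
Variables (u : nat -> C -> C) (e : nat -> R) (r : nat -> nat).
Hypotheses (u_tame : forall k, tame (u k)) (e_gt0 : forall k, 0 < e k).
Hypothesis e_half : forall k, e k.+1 <= e k / 2.
Hypothesis r_incr : forall k, (r k < r k.+1)%N.
Hypothesis u_close : forall k, close_C1 (r k)%:R (e k) (u k) (u k.+1).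

Let e_geom j k : e (j + k)%N <= e k / 2 ^+ j.
Proof.
elim: j => [|j IH]; first by rewrite expr0 divr1.
rewrite addSn; apply: le_trans (e_half _) _.
by rewrite exprSr invfM mulrA ler_pM2r.
Qed.

Let r_mono j k : (r k <= r (j + k))%N.
Proof. by elim: j => // j IH; rewrite addSn; apply: leq_trans IH (ltnW _). Qed.

Let r_ge k : (k <= r k)%N.
Proof. by elim: k => // k IH; apply: leq_ltn_trans IH _. Qed.

Let disc_r j k z : disc (r k)%:R z -> disc (r (j + k)%N)%:R z.
Proof. by apply: disc_le; rewrite ler_nat; exact: r_mono. Qed.

Let u_incr j k z : disc (r k)%:R z ->
  nm (u (j + k).+1 z - u (j + k)%N z) <= e k / 2 ^+ j.
Proof.
move=> /(disc_r j) rz; have [H _] := u_close (j + k).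
exact: le_trans (H _ rz) (e_geom _ _).
Qed.

(** The limit [f] differs from [u k] by a function with Lipschitz constant at most
    [2 * e k] near a given point, so the difference quotients of [f] and [u k]
    differ by at most that, and those of [f] form a Cauchy filter. *)
Lemma tame_limit : exists2 f, entire f &
  forall k z, disc (r k)%:R z -> nm (f z - u k z) <= 2 * e k.
Proof.
have in_disc z : exists k, disc (r k)%:R z.
  exists (Num.trunc (nm z)).+1; rewrite /disc/=; apply/ltW.
  by apply: lt_le_trans (truncnS_gt _) _; rewrite ler_nat; exact: r_ge.
have /choice[f Hf] : forall z, exists l : C, u n z @[n --> \oo] --> l.
  move=> z; have [k rz] := in_disc z.
  have [l ul _] :=
    @geometric_cvg_shift (fun n => u n z) _ _ (fun j => u_incr j rz).
  by exists l.
have fu k z : disc (r k)%:R z -> nm (f z - u k z) <= 2 * e k.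
  by move=> rz; apply: (@geometric_lim (fun n => u n z)) => // j; exact: u_incr.
have fu_lip k z w : disc (r k)%:R z -> disc (r k)%:R w ->
    nm ((f z - u k z) - (f w - u k w)) <= 2 * e k * nm (z - w).
  move=> rz rw.
  have -> : f z - u k z - (f w - u k w) = (f z - f w) - (u k z - u k w) by ring.
  rewrite -mulrA; apply: (@geometric_lim (fun n => u n z - u n w)).
    exact: cvgB.
  move=> j; have [_ H] := u_close (j + k).
  have := H _ _ (disc_r j rz) (disc_r j rw).
  have -> : u (j + k).+1 z - u (j + k)%N z - (u (j + k).+1 w - u (j + k)%N w) =
     (u (j + k).+1 z - u (j + k).+1 w) - (u (j + k)%N z - u (j + k)%N w) by ring.
  move=> /le_trans; apply.
  by rewrite mulrAC; apply: ler_wpM2r (nm_ge0 _) _ _ (e_geom _ _).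
exists f; last exact: fu.
move=> z.
rewrite /derivable.
apply: (@plane_cauchy_cvg R).
move=> d d0.
have [k0 rz0] := in_disc z.
have d60 : 0 < d / 6 by rewrite divr_gt0.
have [j Hj] := half_pow_small (e k0) d60.
pose k := (j + k0).+1.
have ek : 2 * e k < d / 3.
  have := e_half (j + k0); have := e_geom j k0; have := e_gt0 k.
  by rewrite /k; lra.
have rz : (nm z + 1 <= (r k)%:R).
  apply: (@le_trans _ _ ((r (j + k0)).+1)%:R); last by rewrite ler_nat.
  by rewrite -natr1 lerD2r; apply: disc_r.
have [D uD] := (derivable_cdiff (u k) z).1 ((u_tame k).1 z).
exists D; have d30 : 0 < d / 3 by rewrite divr_gt0.
have [t t0 Ht] := uD _ d30.
apply/nbhs_normcP; exists (Num.min t 1); first by rewrite lt_min t0 ltr01.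
move=> h; rewrite subr0 lt_min => /andP[ht h1] h0 /=.
rewrite -[_ *: 1]/(_ * 1) mulr1 -[_ *: _]/(_ * _).
have h0' : 0 < nm h by rewrite nm_gt0.
have rzd : disc (r k)%:R z by apply: le_trans rz; rewrite lerDl.
have rzh : disc (r k)%:R (h + z).
  by apply: le_trans (nmD _ _) (le_trans _ rz); rewrite addrC lerD2l ltW.
have := Ht (h + z); rewrite addrK => /(_ ht) H1.
have := fu_lip k _ _ rzh rzd; rewrite addrK => H2.
rewrite (_ : _ - D = ((u k (h + z) - u k z - D * h) +
  (f (h + z) - u k (h + z) - (f z - u k z))) * h^-1); last by field.
rewrite nmM nmV ltr_pdivrMr//; apply: le_lt_trans (nmD _ _) _.
have : 2 * e k * nm h <= d / 3 * nm h by rewrite ler_pM2r// ltW.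
by have : 0 < d / 3 * nm h by [exact: mulr_gt0]; lra.
Qed.

End TameLimit.

(** The proof of Baire's theorem, with tolerances at least halved at each step so
    that all later corrections stay inside the neighbourhood secured by the
    current one; [tame_limit] plays the part of completeness. *)
Lemma tame_baire (O : nat -> set (C -> C)) :
  (forall k u, tame u -> O k u -> exists (n : nat) d, 0 < d /\
     forall g, entire g -> (forall z, disc n%:R z -> nm (g z - u z) <= d) ->
       O k g) ->
  (forall k u (n : nat) d, tame u -> 0 < d ->
     exists v, [/\ tame v, O k v & close_C1 n%:R d u v]) ->
  forall u (n : nat) d, tame u -> 0 < d ->
  exists f, [/\ entire f, forall z, disc n%:R z -> nm (f z - u z) <= d &
    forall k, O k f].
Proof.
move=> Oopen Odense u0 n0 d0 tu0 d00.
pose state := ((C -> C) * nat * R)%type.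
pose valid (s : state) := tame s.1.1 /\ 0 < s.2.
pose step k (s s' : state) := [/\ valid s', (s.1.2 < s'.1.2)%N, s'.2 <= s.2 / 2,
  close_C1 s.1.2%:R s.2 s.1.1 s'.1.1 &
  forall g, entire g ->
    (forall z, disc s'.1.2%:R z -> nm (g z - s'.1.1 z) <= 2 * s'.2) -> O k g].
have /choice[next Hnext] : forall p : nat * state,
    exists s', valid p.2 -> step p.1 p.2 s'.
  move=> [k [[u n] d]]; rewrite /valid /=.
  have [[tu dp]|nv] := pselect (tame u /\ 0 < d); last by exists (u, n, d) => /nv.
  have [v [tv Ov uv]] := Odense k u n d tu dp.
  have [n' [d' [d'0 Hd']]] := Oopen k v tv Ov.
  exists (v, maxn n.+1 n', Num.min (d' / 2) (d / 2)) => _; split => //=.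
  - by split=> //=; rewrite lt_min !divr_gt0.
  - by rewrite leq_maxl.
  - by rewrite ge_min lexx orbT.
  - move=> g eg Hg; apply: Hd' => // z nz; apply: le_trans (Hg z _) _.
      by apply: disc_le nz; rewrite ler_nat leq_maxr.
    have : Num.min (d' / 2) (d / 2) <= d' / 2 by rewrite ge_min lexx.
    lra.
pose s := fix s k : state :=
  if k is k'.+1 then next (k', s k') else (u0, n0, d0 / 2).
have s_valid k : valid (s k).
  elim: k => [|k IH]; first by split => //=; rewrite divr_gt0.
  by have [] := Hnext (k, s k) IH.
have s_step k : step k (s k) (s k.+1) := Hnext (k, s k) (s_valid k).
have [f ef Hf] := @tame_limit
  (fun k => (s k).1.1) (fun k => (s k).2) (fun k => (s k).1.2)
  (fun k => (s_valid k).1) (fun k => (s_valid k).2)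
  (fun k => let: And5 _ _ H _ _ := s_step k in H)
  (fun k => let: And5 _ H _ _ _ := s_step k in H)
  (fun k => let: And5 _ _ _ H _ := s_step k in H).
exists f; split => //.
  by move=> z nz; have := Hf 0%N z nz; rewrite /= mulrC divfK.
by move=> k; have [_ _ _ _] := s_step k; apply => // z; exact: Hf.
Qed.

(** The space of entire functions is second countable as a subspace of the
    continuous functions: a code lists finitely many rational balls that cover
    a disc, and a rational value on each of them up to a prescribed error. *)
Lemma entire_countable_dense : exists p : nat -> C -> C,
  (forall i, entire (p i)) /\
  forall g (n : nat), entire g -> exists i, (n <= i)%N /\
    forall z, disc n%:R z -> nm (p i z - g z) <= n.+1%:R^-1.
Proof.
pose point (q : rat * rat) : C := (ratr q.1 +i* ratr q.2)%C.
have point_dense z e : 0 < e -> exists q, nm (z - point q) < e.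
  move=> e0; case: z => x y.
  have [q1] : exists q, ratr q \in `](x - e / 2), (x + e / 2)[.
    by apply: rat_in_itvoo; lra.
  have [q2] : exists q, ratr q \in `](y - e / 2), (y + e / 2)[.
    by apply: rat_in_itvoo; lra.
  rewrite !in_itv /= => /andP[y1 y2] /andP[x1 x2]; exists (q1, q2).
  apply: le_lt_trans (nm_ReIm _ _) _ => /=.
  have : `|x - ratr q1| < e / 2 by rewrite ltr_norml; lra.
  have : `|y - ratr q2| < e / 2 by rewrite ltr_norml; lra.
  lra.
pose cell := (rat * rat * nat * (rat * rat))%type.
pose inside (t : cell) z := nm (z - point t.1.1) < t.1.2.+1%:R^-1.
pose fits (c : nat * seq cell) g := entire g /\
  forall t z, t \in c.2 -> inside t z -> nm (g z - point t.2) <= c.1.+1%:R^-1 / 2.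
pose covers (c : nat * seq cell) :=
  forall z, disc c.1%:R z -> exists2 t, t \in c.2 & inside t z.
have coded g n : entire g -> exists c, [/\ c.1 = n, covers c & fits c g].
  move=> eg; have cg := entire_cont eg.
  have inv_gt0 k : 0 < k.+1%:R^-1 :> R by rewrite invr_gt0.
  have local e x : 0 < e -> exists t : cell, inside t x /\
      forall z, inside t z -> nm (g z - point t.2) <= e / 2.
    move=> e0; have e40 : 0 < e / 4 by rewrite divr_gt0.
    have [tau tau0 Htau] := cg x _ e40.
    have [j Hj] : exists j : nat, j.+1%:R^-1 < tau / 2.
      exists (Num.trunc (2 / tau)).
      rewrite -ltf_pV2 ?posrE ?invr_gt0 ?divr_gt0// invrK invf_div.
      exact: truncnS_gt.
    have [q Hq] := point_dense x _ (inv_gt0 j).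
    have [v Hv] := point_dense (g x) _ e40.
    exists (q, j, v); split=> [|z]; first exact: Hq.
    rewrite -[inside _ z]/(nm (z - point q) < j.+1%:R^-1) -[(_, _, v).2]/v => zq.
    have := nmBD (point q) z x; rewrite (nmB (point q) x) => zx.
    have zt : nm (z - x) < tau.
      apply: le_lt_trans zx _; rewrite (splitr tau).
      by apply: ltrD; apply: lt_trans Hj.
    have := Htau _ zt; have := nmBD (g x) (g z) (point v); lra.
  have /choice[t Ht] := fun x => local _ x (inv_gt0 n).
  have [x _|s _ Hs] := @compact_gauge _ _
      (fun x => (t x).1.2.+1%:R^-1 - nm (x - point (t x).1.1))
      (@compact_disc R n%:R).
    by rewrite subr_gt0; have [] := Ht x.
  exists (n, [seq t x | x <- s]); split => //=.
    move=> z /Hs[x xs zx]; exists (t x); first exact: map_f.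
    apply: le_lt_trans (nmBD x _ _) _; rewrite -ltrBrDr; exact: zx.
  by split => // _ z /mapP[x xs ->] /=; have [_] := Ht x; apply.
have /choice[pick Hpick] : forall c, exists g, entire g /\
    ((exists g', fits c g') -> fits c g).
  move=> c; have [[g fg]|nf] := pselect (exists g', fits c g').
    by exists g; split => //; case: fg.
  by exists (fun=> 0); split => //; case: (tame_cst (0 : C)).
exists (fun i => if unpickle (logn 2 i) is Some c then pick c else fun=> 0).
split.
  move=> i; case: unpickle => [c|]; first by case: (Hpick c).
  by case: (tame_cst (0 : C)).
move=> g n eg; have [c [cn cc fc]] := coded g n eg.
(* Each code is the 2-adic valuation of arbitrarily large indices. *)
exists (2 ^ pickle c * n.*2.+1)%N; split.
  apply: leq_trans (leq_pmull _ _); last by rewrite expn_gt0.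
  by rewrite -addnn ltnW// ltnS leq_addr.
have -> : logn 2 (2 ^ pickle c * n.*2.+1) = pickle c.
  rewrite mulnC logn_Gauss ?pfactorK// coprime2n /=.
  by rewrite odd_double.
rewrite pickleK => z; rewrite -cn => /cc[t tc zt].
have [_ /(_ (ex_intro _ g fc))[_ H1]] := Hpick c.
have H2 := H1 _ _ tc zt; have H3 := fc.2 _ _ tc zt.
rewrite (splitr c.1.+1%:R^-1); apply: le_trans (nmBD (point t.2) _ _) _.
by rewrite (nmB (point t.2)) lerD.
Qed.

End Limits.

(** * The topology of the space of entire functions *)
Section CompactOpenTopology.
Variable R : realType.
Local Notation C := (Cplane R).
Implicit Types (z w h : C) (r e : R).

Definition to_entire_space (f : C -> C) (ef : entire f) : entire_space R :=
  SigSub (mem_set ef : (f : {family compact, C -> C}) \in [set f | entire f]).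

Lemma entire_spaceP (f : entire_space R) : entire f.
Proof. exact: (set_valP f). Qed.

(** Every compact set lies in a disc, so uniform closeness on discs gives a basis
    of neighbourhoods. *)
Lemma nbhs_family_disc (f : {family compact, C -> C}) (W : set (C -> C)) :
  nbhs f W -> exists (n : nat) e, 0 < e /\
    forall g : C -> C, (forall z, disc n%:R z -> nm (g z - f z) <= e) -> W g.
Proof.
pose F := filter_from [set x : nat * R | 0 < x.2]
  (fun x => [set g : C -> C | forall z, disc x.1%:R z -> nm (g z - f z) <= x.2]).
have FF : Filter F.
  apply: filter_from_filter; first by exists (0%N, 1) => /=.
  move=> [n e] [n' e'] /= e0 e'0; exists (maxn n n', Num.min e e').
    by rewrite /= lt_min e0.
  move=> g /= Hg; split=> z /= zn.
    apply: le_trans (Hg z _) _; last by rewrite ge_min lexx.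
    by apply: disc_le zn; rewrite ler_nat leq_maxl.
  apply: le_trans (Hg z _) _; last by rewrite ge_min lexx orbT.
  by apply: disc_le zn; rewrite ler_nat leq_maxr.
have Ff : F `=>` nbhs f.
  apply/fam_cvgP => A cA P /uniform_nbhs[E [entE EP]].
  move: entE; rewrite -entourage_ballE => -[d /= d0 dE].
  have [r dr] : exists r, d = (r)%:C%C by apply/complex_realP/gtr0_real.
  subst d; have r0 : 0 < r by rewrite -ltcR.
  have [n An] := compact_sub_disc cA.
  exists (n, r / 2); first by rewrite /= divr_gt0.
  move=> g /= Hg; apply: EP => z Az; apply: dE => /=.
  rewrite -ball_normE /= norm_nm ltcR nmB.
  by have := Hg z (An _ Az); lra.
move=> /Ff[[n e] /= e0 Hg]; exists n, e; split => //.
Qed.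

Lemma nbhs_entire_disc (f : entire_space R) (O : set (entire_space R)) :
  nbhs f O -> exists (n : nat) e, 0 < e /\
    forall g : entire_space R,
      (forall z, disc n%:R z -> nm (g z - f z) <= e) -> O g.
Proof.
rewrite /nbhs /=; case=> _ /= [] [W oW <- /= Wf WO].
have /nbhs_family_disc[n [e [e0 He]]] := open_nbhs_nbhs (conj oW Wf).
by exists n, e; split=> // g Hg; apply: WO => /=; apply: He.
Qed.

Lemma nbhs_disc_entire (f : entire_space R) r e : 0 < e ->
  nbhs f [set g : entire_space R | forall z, disc r z -> nm (g z - f z) <= e].
Proof.
move=> e0.
have entE : entourage [set xy : C * C | nm (xy.2 - xy.1) <= e].
  rewrite -entourage_ballE; exists (e%:C)%C; first by rewrite /= ltcR.
  by move=> [x y] /=; rewrite -ball_normE /= norm_nm ltcR nmB => /ltW.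
have := fam_nbhs (set_val f : {family compact, C -> C}) entE
  (@compact_disc R r).
by move=> /(@initial_continuous _ _ set_val f).
Qed.

Lemma sup_norm_on_le (K : set C) (h : C -> C) B : 0 <= B ->
  (forall z, K z -> nm (h z) <= B) -> 0 <= sup_norm_on K h <= B.
Proof.
move=> B0 KB; rewrite /sup_norm_on; set S := [set _ | _ in _].
have [->|S0] := eqVneq S set0; first by rewrite sup0 lexx.
have /set0P[_ [z Kz _]] := S0.
have S_ub : ubound S B by move=> _ [w Kw <-]; exact: KB.
have Sz : S (nm (h z)) by exists z.
rewrite ge_sup//; last exact/set0P.
rewrite andbT; apply: le_trans (nm_ge0 (h z)) _; apply: sup_upper_bound => //.
by split; [exact/set0P|exists B].
Qed.

Lemma sup_norm_on_ge (K : set C) (h : C -> C) z : ccont h -> compact K -> K z ->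
  nm (h z) <= sup_norm_on K h.
Proof.
move=> ch cK Kz; have [B B0 HB] := bounded_on_compact ch cK.
apply: sup_upper_bound; last by exists z.
by split; [exists (nm (h z)), z|exists B => _ [w Kw <-]; exact: HB].
Qed.

Lemma nm_cexp2pi (a : R) : nm (cexp2pi a) = 1.
Proof. by rewrite /= cos2Dsin2 sqrtr1. Qed.

(** If the two values agree then [cos (2 pi (b - a)) = 1], hence
    [sin (pi (b - a)) = 0] with [0 <= pi (b - a) < pi]. *)
Lemma cexp2pi_inj (a b : R) : 0 <= a < 1 -> 0 <= b < 1 ->
  cexp2pi a = cexp2pi b -> a = b.
Proof.
wlog ab : a b / a <= b => [H a01 b01 E|].
  by have [ab|/ltW ba] := leP a b; [exact: H|apply/esym/H].
move=> /andP[a0 a1] /andP[b0 b1] [Ec Es].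
have : sin (pi * (b - a)) ^+ 2 = 0 :> R.
  have : cos ((pi * (b - a)) *+ 2) = 1 :> R.
    have -> : (pi * (b - a)) *+ 2 = 2 * pi * b - 2 * pi * a.
      by rewrite mulr2n; ring.
    by rewrite cosB Ec Es -!expr2 cos2Dsin2.
  by rewrite cos_mulr2n; have := cos2Dsin2 (pi * (b - a)); lra.
move=> /eqP; rewrite sqrf_eq0 => /eqP s0.
apply/eqP; rewrite eq_le ab /= leNgt; apply/negP => ltab.
have : 0 < sin (pi * (b - a)) :> R.
  apply: sin_gt0_pi; have p0 := pi_gt0 R; rewrite mulr_gt0 ?subr_gt0//=.
  by rewrite gtr_pMr//; lra.
by rewrite s0 ltxx.
Qed.

End CompactOpenTopology.

(** * [SA] as a countable intersection of dense open sets *)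
Section Approximants.
Variables (R : realType) (theta : nat -> R) (m : nat -> Cplane R).
Local Notation C := (Cplane R).
Implicit Types (f g p u : C -> C).

(** The bound [b] leaves a margin below [1 / (n + 1)], which is what makes the
    condition open. *)
Definition approximates p n f := exists s b, b < n.+1%:R^-1 /\
  forall l z, (l < n)%N -> disc n%:R z ->
    nm (f (z + m s * cexp2pi (theta l)) - p z) <= b.

Lemma approximates_near p n f : approximates p n f ->
  exists (N : nat) d, 0 < d /\
    forall g, (forall z, disc N%:R z -> nm (g z - f z) <= d) ->
      approximates p n g.
Proof.
move=> [s [b [b_lt Hb]]]; rewrite -subr_gt0 in b_lt.
pose d := (n.+1%:R^-1 - b) / 2.
have d0 : 0 < d by rewrite divr_gt0.
exists (Num.trunc (n%:R + nm (m s))).+1, d; split=> // g Hg.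
exists s, (b + d); split; first by rewrite -ltrBrDl gtr_pMr// invf_lt1// ltr1n.
move=> l z ln zn; have := Hb l z ln zn; set q := z + _ => Hq.
have /Hg : disc (Num.trunc (n%:R + nm (m s))).+1%:R q.
  apply/ltW; apply: le_lt_trans (truncnS_gt _).
  by apply: le_trans (nmD _ _) _; rewrite nmM nm_cexp2pi mulr1 lerD2r.
by have := nmBD (f q) (g q) (p z); lra.
Qed.

Lemma open_approximates p n :
  open [set f : entire_space R | approximates p n f].
Proof.
rewrite openE => f /= /approximates_near[N [d [d0 Hd]]].
by apply: filterS (nbhs_disc_entire f N%:R d0) => g; exact: Hd.
Qed.

(** The index [i] is at the same time the precision and the name of the target
    [p i]; for this reason [p_dense] asks for approximants of large index. *)
Section SA_bigcap.
Variable p : nat -> C -> C.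
Hypothesis p_entire : forall i, entire (p i).
Hypothesis p_dense : forall g (n : nat), entire g -> exists i, (n <= i)%N /\
  forall z, disc n%:R z -> nm (p i z - g z) <= n.+1%:R^-1.

Lemma SA_approximates (f : entire_space R) i :
  SA theta m f -> approximates (p i) i f.
Proof.
move=> /(_ (to_entire_space (@p_entire i)))[lam [lam_m Hlam]].
have i0 : 0 < i.+1%:R^-1 / 2 :> R by rewrite divr_gt0// invr_gt0.
have [N _ HN] : \forall n \near \oo, forall l : 'I_i,
    sup_norm_on (disc i%:R)
      (fun z => f (z + lam n * cexp2pi (theta l)) - p i z) < i.+1%:R^-1 / 2.
  apply: filter_forall => l.
  have /cvgrPdist_lt/(_ _ i0) :=
    Hlam (theta l) (imageT _ _) _ (@compact_disc R i%:R).
  apply: filterS => n; rewrite sub0r normrN; apply: le_lt_trans; exact: ler_norm.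
have [s _ ms] := lam_m N; exists s, (i.+1%:R^-1 / 2); split.
  by rewrite gtr_pMr ?invr_gt0// invf_lt1// ltr1n.
move=> l z li zi; rewrite ms; apply: ltW.
apply: le_lt_trans (HN N (leqnn N) (Ordinal li)) => /=.
apply: (@sup_norm_on_ge _ _
  (fun z => f (z + lam N * cexp2pi (theta l)) - p i z)) => //.
  apply: entire_cont => x; apply: derivableB; last exact: p_entire.
  by apply: entire_shift; exact: entire_spaceP.
exact: compact_disc.
Qed.

(** For a target [g] and each [n], take [i >= n] with [p i] close to [g] on the disc
    of radius [n]; the [m s] that serves [p i] then serves [g], for all directions
    [theta l] with [l < n] at once. *)
Lemma approximates_SA (f : entire_space R) :
  (forall i, approximates (p i) i f) -> SA theta m f.
Proof.
move=> Hf g.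
have /choice[s Hs] : forall n : nat, exists s,
    forall l z, (l < n)%N -> disc n%:R z ->
    nm (f (z + m s * cexp2pi (theta l)) - g z) <= 2 * n.+1%:R^-1.
  move=> n; have [i [ni Hi]] := p_dense n (@entire_spaceP _ g).
  have [s [b [b_lt Hb]]] := Hf i; exists s => l z ln zn.
  apply: le_trans (nmBD (p i z) _ _) _; rewrite mulr_natl mulr2n.
  apply: lerD; last exact: Hi.
  apply: (@le_trans _ _ i.+1%:R^-1).
    apply: le_trans (ltW b_lt); apply: Hb; first exact: leq_trans ni.
    by apply: disc_le zn; rewrite ler_nat.
  by rewrite lef_pV2 ?posrE// ler_nat.
exists (m \o s); split=> [n|_ [l _ <-] K cK]; first by exists (s n).
have [n0 Kn0] := compact_sub_disc cK.
apply/cvgrPdist_lt => e e0.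
exists (maxn (Num.trunc (2 / e)) (maxn l.+1 n0)) => // n /=.
rewrite !geq_max => /and3P[ne ln n0n].
have n2 : 2 * n.+1%:R^-1 < e.
  rewrite ltr_pdivrMr// mulrC -ltr_pdivrMr//.
  by apply: lt_le_trans (truncnS_gt _) _; rewrite ler_nat.
have /andP[sup0 sup2] : 0 <= sup_norm_on K
    (fun z => f (z + (m \o s) n * cexp2pi (theta l)) - g z) <= 2 * n.+1%:R^-1.
  apply: sup_norm_on_le; first by rewrite mulr_ge0.
  move=> z /Kn0 zn0; apply: Hs => //.
  by apply: disc_le zn0; rewrite ler_nat.
by rewrite sub0r normrN ger0_norm//; exact: le_lt_trans sup2 n2.
Qed.

Lemma SA_bigcap :
  SA theta m = \bigcap_i [set f : entire_space R | approximates (p i) i f].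
Proof.
apply/seteqP; split=> f.
  by move=> Sf i _; exact: SA_approximates.
by move=> Hf; apply: approximates_SA => i; exact: Hf.
Qed.

End SA_bigcap.

Hypothesis theta_inj : injective theta.
Hypothesis theta_range : forall n, 0 <= theta n < 1.
Hypothesis m_unbounded : ~ bounded_set (range m).

Lemma unbounded_nm (B : R) : exists s, B < nm (m s).
Proof.
apply: contrapT => nB; apply: m_unbounded; exists (B%:C)%C; split.
  by apply/complex_realP; exists B.
move=> x Bx _ [s _ <-]; apply: le_trans (ltW Bx); rewrite norm_nm lecR leNgt.
by apply/negP => Bs; apply: nB; exists s.
Qed.

(** Replace [p] by a tame approximant and apply [universal_step], with a third of
    the precision for each of the two errors. *)
Lemma approximates_dense p n u (N : nat) d : entire p -> tame u -> 0 < d ->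
  exists v, [/\ tame v, approximates p n v & close_C1 N%:R d u v].
Proof.
move=> ep tu d0.
have n0 : 0 < n.+1%:R^-1 / 3 :> R by rewrite divr_gt0// invr_gt0.
have [q tq Hq] := tame_approx n%:R ep n0.
pose x (l : 'I_n) : C := cexp2pi (theta l).
have x_inj : injective x.
  by move=> k l /(cexp2pi_inj (theta_range _) (theta_range _))/theta_inj/val_inj.
have x0 l : x l != 0 by rewrite -nm_gt0 nm_cexp2pi.
pose e := Num.min d (n.+1%:R^-1 / 3); have e0 : 0 < e by rewrite lt_min d0.
have [v [s [tv v1 v2 v3]]] :=
  universal_step (Num.max N%:R n%:R) x_inj x0 unbounded_nm tu tq e0.
have ed : e <= d by rewrite ge_min lexx.
have en : e <= n.+1%:R^-1 / 3 by rewrite ge_min lexx orbT.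
have inN z : disc N%:R z -> disc (Num.max N%:R n%:R) z.
  by apply: disc_le; rewrite le_max lexx.
have inn z : disc n%:R z -> disc (Num.max N%:R n%:R) z.
  by apply: disc_le; rewrite le_max lexx orbT.
exists v; split=> //.
  exists s, (n.+1%:R^-1 / 3 + n.+1%:R^-1 / 3); split.
    rewrite -mulrDr gtr_pMr ?invr_gt0//; lra.
  move=> l z ln zn; apply: le_trans (nmBD (q z) _ _) _; apply: lerD.
    have -> : cexp2pi (theta l) = x (Ordinal ln) by [].
    by apply: le_trans en; apply: v3; exact: inn.
  exact: Hq.
split=> [z zN|z w zN wN]; first by apply: le_trans ed; apply: v1; exact: inN.
apply: (@le_trans _ _ (e * nm (z - w))); first by apply: v2; exact: inN.
by rewrite ler_wpM2r ?nm_ge0.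
Qed.

End Approximants.

Theorem theorem2p6 (R : realType) (theta : nat -> R) (m : nat -> Cplane R)
    (theta_inj : injective theta)
    (theta_range : forall n, 0 <= theta n < 1)
    (m_unbounded : ~ bounded_set (range m)) :
  [/\ dense (SA theta m), Gdelta (SA theta m) & SA theta m !=set0].
Proof.
have [p [ep p_dense]] := entire_countable_dense R.
have SAE := SA_bigcap theta m ep p_dense.
have SA_dense : dense (SA theta m).
  move=> O [f0 Of0] oO.
  have [n [e [e0 He]]] := nbhs_entire_disc (open_nbhs_nbhs (conj oO Of0)).
  have e20 : 0 < e / 2 by rewrite divr_gt0.
  have [u tu Hu] := tame_approx n%:R (@entire_spaceP _ f0) e20.
  have [k v tv Ov|k v N d tv d0|f [ef fu Of]] :=
    @tame_baire R (fun k => approximates theta m (p k) k) _ _ u n (e / 2) tu e20.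
  - have [N [d [d0 Hd]]] := approximates_near Ov.
    by exists N, d; split=> // g _; exact: Hd.
  - exact: approximates_dense.
  - exists (to_entire_space ef); split.
      apply: He => z zn; have := fu z zn; have := Hu z zn.
      rewrite -[to_entire_space ef z]/(f z).
      by have := nmBD (u z) (f z) (entire_fun f0 z); lra.
    by rewrite SAE => k _; exact: Of.
split=> //.
- exists (fun i => [set f : entire_space R | approximates theta m (p i) i f]) => //.
  by move=> i; exact: open_approximates.
- have [|f [_ Sf]] := SA_dense setT _ openT; last by exists f.
  by exists (to_entire_space (tame_cst (0 : Cplane R)).1).
Qed.
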